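(* Let $\mathcal M=(S,S_\Box,S_\bigcirc,\longrightarrow,P)$ be a universally transient countable MDP (possibly infinitely branching), let $Col:S\to\{0,1\}$ be a coloring, let $\varphi=\mathtt{Parity}(Col)$ (a co-Büchi objective) and let $\varepsilon>0$. There exists an MD strategy $\sigma'$ such that for every state $s\in S$, $\mathcal P_{\mathcal M,s,\sigma'}(\varphi)\ge\mathtt{val}_{\mathcal M,\varphi}(s)-\varepsilon$.
   Context: MDPs: an MDP is a tuple $\mathcal M=(S,S_\Box,S_\bigcirc,\longrightarrow,P)$ where $S$ is a countable set of states partitioned into controlled states $S_\Box$ and random states $S_\bigcirc$, $\longrightarrow\subseteq S\times S$ is a transition relation in which every state has at least one (possibly infinitely many) successor, and $P$ assigns to each random state $s$ a probability distribution $P(s)$ on its successors. A run is an infinite sequence $s_0s_1\cdots$ with $s_i\longrightarrow s_{i+1}$ for all $i$. A strategy is a function $\sigma:S^*S_\Box\to\mathcal D(S)$ (where $\mathcal D(S)$ is the set of probability distributions on $S$) assigning to each finite sequence $\rho s$ ending in a controlled state $s$ a distribution over successors of $s$. A strategy $\sigma$ and initial state $s_0$ induce the usual probability measure $\mathcal P_{\mathcal M,s_0,\sigma}$ on infinite sequences starting in $s_0$ (at random states the successor is drawn according to $P$). A strategy is memoryless deterministic (MD) if it is given by a function $\sigma:S_\Box\to S$ choosing a successor of each controlled state. For a measurable objective $\varphi$ (a set of runs), $\mathtt{val}_{\mathcal M,\varphi}(s)=\sup_\sigma \mathcal P_{\mathcal M,s,\sigma}(\varphi)$, the supremum over all strategies.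 $\mathtt{Parity}(Col)$ is the set of runs such that the largest color occurring infinitely often along the run is even. $\mathtt{Transience}$ is the set of runs that visit no state infinitely often. $\mathcal M$ is universally transient if $\mathcal P_{\mathcal M,s_0,\sigma}(\mathtt{Transience})=1$ for all states $s_0$ and all strategies $\sigma$. *)

(* Defs.v *)
From HB Require Import structures.
From mathcomp Require Import all_boot all_order all_algebra.
From mathcomp Require Import all_classical all_reals all_analysis.

Set Implicit Arguments.
Unset Strict Implicit.
Unset Printing Implicit Defensive.

Import Order.TTheory GRing.Theory Num.Theory.
Import numFieldTopology.Exports.

Local Open Scope classical_set_scope.
Local Open Scope ring_scope.

Definition cylinder (S : Type) (w : seq S) : set (nat -> S) :=
  [set x | mkseq x (size w) = w].

(* The library's measurable types are pointed.  The initial state provides the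
   point (the constant sequence), so that S need not be assumed nonempty; it
   plays no role in the sigma-algebra. *)
Definition trajectory (S : countType) (s0 : S) : Type := nat -> S.

HB.instance Definition _ (S : countType) (s0 : S) :=
  gen_eqMixin (trajectory s0).
HB.instance Definition _ (S : countType) (s0 : S) :=
  gen_choiceMixin (trajectory s0).
HB.instance Definition _ (S : countType) (s0 : S) :=
  isPointed.Build (trajectory s0) (fun=> s0).

Definition cylinders (S : countType) (s0 : S) : set (set (trajectory s0)) :=
  [set cylinder w | w in [set: seq S]].

Arguments cylinders {S} s0.

Notation runspace s0 := (g_sigma_algebraType (cylinders s0)).

(* Existence of a probability on sequences with given cylinder weights: the
   interval [0, 1[ is cut into nested intervals `cell w` of length p w, and
   Lebesgue measure is transported along the coding map. *)
Section extension.
Context (R : realType) (S : countType) (s0 : S) (p : seq S -> R).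
Hypothesis p_ge0 : forall w, 0 <= p w.
Hypothesis p_nil : p [::] = 1.
Hypothesis p_rcons : forall w,
  (\esum_(t in [set: S]) (p (rcons w t))%:E = (p w)%:E)%E.

Let q w n : R := if @pickle_inv S n is Some t then p (rcons w t) else 0.

Let q_ge0 w n : 0 <= q w n.
Proof. by rewrite /q; case: pickle_inv. Qed.

Let q_pickle w t : q w (pickle t) = p (rcons w t).
Proof. by rewrite /q pickleK_inv. Qed.

Let Q w n : R := \sum_(i < n) q w i.

Let QS w n : Q w n.+1 = Q w n + q w n.
Proof. by rewrite /Q big_ord_recr. Qed.

Let Q_nd w : {homo Q w : m n / (m <= n)%N >-> m <= n}.
Proof. by apply: homo_leq => // [|n]; [exact: le_trans|rewrite QS lerDl]. Qed.

Let Q_cvg w : (fun n => (Q w n)%:E) @ \oo --> (p w)%:E.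
Proof.
have -> : (p w)%:E = (\sum_(0 <= i <oo) (q w i)%:E)%E.
  rewrite nneseries_esumT; last by move=> n; rewrite lee_fin.
  rewrite -p_rcons.
  under eq_esum do rewrite -q_pickle.
  rewrite -(@esum_image R S nat setT (@pickle S) (fun n => (q w n)%:E)).
    rewrite esum_mkcond; apply: eq_esum => n _.
    case: ifPn => // /negP nr; rewrite /q.
    case E : (pickle_inv n) => [t|//]; exfalso; apply: nr; rewrite inE.
    by exists t => //; have := @pickle_invK S n; rewrite /oapp E.
  by move=> s t _ _ /(pcan_inj (@pickleK S)).
apply: cvg_trans; last first.
  by apply: (@is_cvg_nneseries _ _ xpredT 0%N) => n _ _; rewrite lee_fin.
apply: near_eq_cvg; near=> n.
by rewrite /Q -sumEFin big_mkord.
Unshelve. all: by end_near. Qed.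

Let Q_le w n : Q w n <= p w.
Proof.
rewrite -lee_fin -(cvg_lim _ (@Q_cvg w))//.
apply: lime_ge; first by apply/cvg_ex; exists (p w)%:E; exact: Q_cvg.
by exists n => // k /= nk; rewrite lee_fin Q_nd.
Qed.

Let Q_gt w y : y < p w -> exists n, y < Q w n.
Proof.
move=> yp; apply: contrapT => /forallNP H.
suff : ((p w)%:E <= y%:E)%E by rewrite lee_fin leNgt yp.
rewrite -(cvg_lim _ (@Q_cvg w))//; apply: lime_le.
  by apply/cvg_ex; exists (p w)%:E; exact: Q_cvg.
by near=> n; rewrite lee_fin leNgt; apply/negP/H.
Unshelve. all: by end_near. Qed.

Let Fixpoint lo_from v w {struct w} : R :=
  if w is t :: w' then Q v (pickle t) + lo_from (rcons v t) w' else 0.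

Let lo := lo_from [::].

Let lo_rcons w t : lo (rcons w t) = lo w + Q w (pickle t).
Proof.
rewrite /lo -[in Q _ _](cat0s w); elim: w [::] => [|u w IH] v /=.
  by rewrite cats0 addr0 add0r.
by rewrite IH cat_rcons addrA.
Qed.

Let cell w : set R := [set` `[lo w, lo w + p w[].

Let cellP w x : cell w x <-> lo w <= x < lo w + p w.
Proof. by rewrite /cell /= in_itv. Qed.

Let cell_rcons_sub w t : cell (rcons w t) `<=` cell w.
Proof.
move=> x /cellP; rewrite lo_rcons => /andP[h1 h2]; apply/cellP/andP; split.
  by apply: le_trans h1; rewrite lerDl; exact: sumr_ge0.
apply: (lt_le_trans h2); rewrite -addrA lerD2l -q_pickle -QS; exact: Q_le.
Qed.

Let cell_disj w t u x :
  (pickle t < pickle u)%N -> cell (rcons w t) x -> ~ cell (rcons w u) x.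
Proof.
move=> tu /cellP; rewrite lo_rcons => /andP[_ h] /cellP.
rewrite lo_rcons => /andP[h' _]; have := lt_le_trans h (lexx _).
apply/negP; rewrite -leNgt; apply: le_trans h'.
by rewrite -addrA lerD2l -q_pickle -QS Q_nd.
Qed.

Let cell_inj w t u x : cell (rcons w t) x -> cell (rcons w u) x -> t = u.
Proof.
move=> ht hu; case: (ltngtP (pickle t) (pickle u)) => h.
- by have := cell_disj h ht hu.
- by have := cell_disj h hu ht.
- exact: (pcan_inj (@pickleK S)).
Qed.

Let next w x : S := xget s0 [set t | cell (rcons w t) x].

Let cell_next w x : cell w x -> cell (rcons w (next w x)) x.
Proof.
move=> /cellP/andP[h1 h2].
suff : exists t, cell (rcons w t) x by rewrite /next => -[t ht]; case: xgetP => [//|/(_ t)].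
have /ex_minnP[[|n] hn hmin] : exists n, x - lo w < Q w n.
  by apply: Q_gt; rewrite ltrBlDl.
  by move: hn; rewrite /Q big_ord0 ltNge subr_ge0 h1.
have hn' : Q w n <= x - lo w.
  by rewrite leNgt; apply/negP => /hmin; rewrite ltnn.
move: (hn); rewrite QS /q; case E : (pickle_inv n) => [t|]; last first.
  by rewrite addr0 ltNge hn'.
have tn : pickle t = n by have := @pickle_invK S n; rewrite /oapp E.
move=> hn2; exists t; apply/cellP; rewrite lo_rcons tn -lerBrDl hn' /=.
by rewrite -addrA -ltrBlDl.
Qed.

Let Fixpoint code n x : seq S :=
  if n is n'.+1 then rcons (code n' x) (next (code n' x) x) else [::].

Let X (x : R) : runspace s0 :=
  if x \in cell [::] then fun n => next (code n x) x else fun=> s0.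

Let XE x n : cell [::] x -> mkseq (X x) n = code n x.
Proof.
move=> hx; rewrite /X mem_set//; elim: n => [//|n IH].
by rewrite mkseqS IH.
Qed.

Let cell_code x n : cell [::] x -> cell (code n x) x.
Proof. by move=> hx; elim: n => //= n; exact: cell_next. Qed.

Let code_cell w x : cell w x -> cell [::] x /\ code (size w) x = w.
Proof.
elim/last_ind: w => [//|w t IH] h; have [h0 e] := IH (cell_rcons_sub h).
split=> //; rewrite size_rcons /= e; congr rcons.
by apply: (cell_inj _ h); apply: cell_next; exact: cell_rcons_sub h.
Qed.

Let X_cylinder w : X @^-1` cylinder w `&` cell [::] = cell w.
Proof.
apply/seteqP; split => x.
  by move=> [/= + hx]; rewrite /cylinder /= XE// => e; rewrite -e; exact: cell_code.
by move=> /code_cell[hx e]; split => //=; rewrite /cylinder /= XE.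
Qed.

Let measurable_X : measurable_fun [set: measurableTypeR R] X.
Proof.
have := @measurability _ _ (measurableTypeR R) (runspace s0) setT X
  (cylinders s0).
apply=> //.
move=> _ [_ [w _ <-] <-]; rewrite setTI.
rewrite -(setIT (X @^-1` _)) -(setUv (cell [::])) setIUr X_cylinder.
apply: measurableU; first exact: measurable_itv.
have [h|h] := pselect (cylinder w (fun=> s0)).
  rewrite setIidr; first by apply: measurableC; exact: measurable_itv.
  by move=> x /= hx; rewrite /X memNset.
rewrite (_ : _ `&` _ = set0) //; apply/seteqP; split=> // x /= [hx nx].
by apply: h; move: hx; rewrite /X memNset.
Qed.

Lemma sequence_measure_exists :
  {mu : probability (runspace s0) R | forall w, mu (cylinder w) = (p w)%:E}.
Proof.
have m0 : measurable (cell [::] : set (measurableTypeR R)).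
  exact: measurable_itv.
pose X' : {mfun measurableTypeR R >-> runspace s0} :=
  HB.pack (X : measurableTypeR R -> runspace s0)
      (isMeasurableFun.Build _ _ (measurableTypeR R) (runspace s0) X measurable_X).
have m1 : mrestr (@lebesgue_measure R) m0 setT = 1%E.
  rewrite /mrestr setTI /cell lebesgue_measure_itv /= p_nil.
  by rewrite lte_fin ltrDl ltr01 -EFinB addrC addKr.
pose P : probability (measurableTypeR R) R :=
  HB.pack (mrestr (@lebesgue_measure R) m0)
    (Measure_isProbability.Build _ _ _ (mrestr (@lebesgue_measure R) m0) m1).
exists (distribution P X') => w.
rewrite /distribution /pushforward /= /mrestr X_cylinder.
rewrite lebesgue_measure_itv /= lte_fin ltrDl -EFinB addrC addKr.
by case: ltP => // h; congr EFin; apply/eqP; rewrite eq_le h p_ge0.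
Qed.

End extension.

Lemma cylinderI (S : countType) (s0 : S) :
  setI_closed (set0 |` cylinders s0).
Proof.
have sub (x : nat -> S) w v : (size w <= size v)%N -> cylinder w x ->
    cylinder v x -> cylinder v `<=` (cylinder w : set (nat -> S)).
  move=> wv; rewrite /cylinder /= => xw xv y /= yv.
  have E z : mkseq z (size w) = take (size w) (mkseq z (size v)) :> seq S.
    by rewrite -map_take take_iota (minn_idPl wv).
  by rewrite E yv -xv -E.
move=> A B [->|[w _ <-]]; first by rewrite set0I; left.
case=> [->|[v _ <-]]; first by rewrite setI0; left.
have [->|/set0P[x [xw xv]]] := eqVneq (cylinder w `&` cylinder v) set0.
  by left.
right; case: (leqP (size w) (size v)) => [|/ltnW] h.
  by exists v => //; rewrite setIidr//; exact: sub xw xv.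
by exists w => //; rewrite setIidl//; exact: sub xv xw.
Qed.

Lemma sequence_measure_unique (R : realType) (S : countType) (s0 : S)
    (mu nu : probability (runspace s0) R) :
  (forall w, mu (cylinder w) = nu (cylinder w)) ->
  forall A, measurable A -> mu A = nu A.
Proof.
move=> E A mA.
have cylT : cylinder [::] = [set: runspace s0] by apply/seteqP; split.
apply: (@measure_unique _ R (runspace s0) (set0 |` cylinders s0) (fun=> setT)
  _ _ _ _ mu nu) => //.
- apply/seteqP; split; apply: smallest_sub.
  + exact: smallest_sigma_algebra.
  + by move=> C cC; apply: sub_sigma_algebra; right.
  + exact: smallest_sigma_algebra.
  + by move=> C [->|]; [exact: sigma_algebra0|exact: sub_sigma_algebra].
- exact: cylinderI.
- by move=> n; right; exists [::].
- by rewrite bigcup_const.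
- move=> B [->|[w _ <-]]; first by rewrite !measure0.
  exact: E.
- by move=> _ /=; rewrite ltey_eq fin_num_measure.
Qed.

Lemma esumZ_EFin (R : realType) (T : choiceType) (c : R) (a : T -> R) :
  0 <= c -> (forall t, 0 <= a t) ->
  (\esum_(t in [set: T]) (c * a t)%:E = c%:E * \esum_(t in [set: T]) (a t)%:E)%E.
Proof.
have ub (d : R) (b : T -> R) : 0 <= d -> (forall t, 0 <= b t) ->
    (\esum_(t in [set: T]) (d * b t)%:E <=
     d%:E * \esum_(t in [set: T]) (b t)%:E)%E.
  move=> d0 b0; apply: ge_ereal_sup => _ [A fA <-].
  under eq_fsbigr do rewrite EFinM.
  rewrite -ge0_mule_fsumr; last by move=> t; rewrite lee_fin.
  by rewrite lee_wpmul2l ?lee_fin//; apply: ereal_sup_ubound; exists A.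
rewrite le_eqVlt => /predU1P[<- a0|c0 a0].
  by rewrite mul0e; apply: esum1 => t _; rewrite mul0r.
apply/eqP; rewrite eq_le ub ?(ltW c0)//=.
have := ub c^-1 (fun t => c * a t).
rewrite invr_ge0 (ltW c0) => /(_ isT (fun t => mulr_ge0 (ltW c0) (a0 t))).
under eq_esum do rewrite mulKf ?gt_eqF//.
move=> /(lee_wpmul2l (x := c%:E)); rewrite lee_fin (ltW c0) => /(_ isT).
by rewrite muleA -EFinM divff ?gt_eqF// mul1e.
Qed.

Section measurable_events.
Context (S : countType) (s0 : S).

Lemma measurable_prefix (n : nat) (B : set (seq S)) :
  measurable ([set x | B (mkseq x n)] : set (runspace s0)).
Proof.
rewrite (_ : [set x | B (mkseq x n)] =
    \bigcup_(w : seq S) (if pselect (B w /\ size w = n) then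
      (cylinder w : set (runspace s0)) else set0)).
  apply: countable_bigcupT_measurable; first exact: countableP.
  move=> w; case: (pselect _) => h; last exact: measurable0.
  by apply: sub_sigma_algebra; exists w.
apply/seteqP; split => [x Bx|x [w _]].
  exists (mkseq x n) => //; case: (pselect _) => [h|[]].
    by rewrite /cylinder /= size_mkseq.
  by rewrite size_mkseq.
by case: (pselect _) => // -[Bw wn]; rewrite /cylinder /= wn => ->.
Qed.

Lemma measurable_coord (n : nat) (B : set S) :
  measurable ([set x | B (x n)] : set (runspace s0)).
Proof.
rewrite (_ : [set x | B (x n)] =
    [set x | [set w | B (nth s0 w n)] (mkseq x n.+1)]).
  exact: measurable_prefix.
by apply/seteqP; split=> x /=; rewrite nth_mkseq.
Qed.

Lemma measurable_infinitely_often (B : set S) :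
  measurable ([set x | infinite_set [set n | B (x n)]] : set (runspace s0)).
Proof.
rewrite (_ : [set x | _] = \bigcap_m \bigcup_(n in [set n | (m <= n)%N])
    ([set x | B (x n)] : set (runspace s0))).
  apply: bigcapT_measurable => m; apply: bigcup_measurable => n _.
  exact: measurable_coord.
apply/seteqP; split => x /=.
  move=> inf m _; apply: contrapT => no; apply: inf.
  apply: (@sub_finite_set _ _ `I_m); last exact: finite_II.
  move=> n /= Bn; rewrite ltnNge; apply/negP => mn.
  by apply: no; exists n.
move=> h fin; have [m hm] : exists m, forall n, B (x n) -> (n < m)%N.
  have /finite_seqP[r rE] := fin.
  exists (\max_(i <- r) i).+1 => n Bn; rewrite ltnS.
  by apply: leq_bigmax_seq => //; move: (Bn : [set n | B (x n)] n); rewrite rE.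
have [n /= mn /hm] := h m Logic.I; by rewrite ltnNge mn.
Qed.

End measurable_events.

Section mdp.
Context (R : realType).

Definition is_distribution (S : choiceType) (A : set S) (d : S -> R) : Prop :=
  [/\ forall t, 0 <= d t,
      (\esum_(t in [set: S]) (d t)%:E = 1)%E
    & forall t, d t != 0 -> A t].

(* prob s is meaningful only when s is random. *)
Record mdp (S : countType) := Mdp {
  controlled : pred S;
  step : S -> set S;
  prob : S -> S -> R;
  step_total : forall s, step s !=set0;
  prob_distribution :
    forall s, ~~ controlled s -> is_distribution (step s) (prob s)
}.

Context (S : countType) (M : mdp S).

(* choice sigma rho s is the distribution chosen by sigma on the history
   rho ++ [:: s]; it is meaningful only when s is controlled. *)
Record strategy := Strategy {
  choice :> seq S -> S -> S -> R;
  choice_distribution : forall rho s,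
    controlled M s -> is_distribution (step M s) (choice rho s)
}.

(* That f s is a successor of s follows from choice_distribution. *)
Definition memoryless_deterministic (sigma : strategy) : Prop :=
  exists f : S -> S, forall rho s t,
    controlled M s -> sigma rho s t = (t == f s)%:R.

Definition transition (sigma : strategy) (rho : seq S) (s : S) : S -> R :=
  if controlled M s then sigma rho s else prob M s.

(* Probability of continuing with w when the history so far is rho ++ [:: s]. *)
Fixpoint path_prob (sigma : strategy) (rho : seq S) (s : S) (w : seq S) : R :=
  if w is t :: w' then
    transition sigma rho s t * path_prob sigma (rcons rho s) t w'
  else 1.

Definition cylinder_prob (sigma : strategy) (s0 : S) (w : seq S) : R :=
  if w is s :: w' then (s == s0)%:R * path_prob sigma [::] s w' else 1.

Lemma transition_distribution sigma rho s :
  is_distribution (step M s) (transition sigma rho s).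
Proof.
rewrite /transition; case: ifPn => [|/prob_distribution //].
exact: choice_distribution.
Qed.

Lemma path_prob_ge0 sigma rho s w : 0 <= path_prob sigma rho s w.
Proof.
elim: w rho s => [|t w IH] rho s //=; apply: mulr_ge0 => //.
by have [] := transition_distribution sigma rho s.
Qed.

Lemma path_prob_rcons sigma rho s w t :
  path_prob sigma rho s (rcons w t) =
  path_prob sigma rho s w * transition sigma (rho ++ belast s w) (last s w) t.
Proof.
elim: w rho s => [|u w IH] rho s /=; first by rewrite mulr1 mul1r cats0.
by rewrite IH cat_rcons mulrA.
Qed.

Lemma cylinder_prob_ge0 sigma s0 w : 0 <= cylinder_prob sigma s0 w.
Proof. by case: w => //= s w; rewrite mulr_ge0// path_prob_ge0. Qed.

Lemma cylinder_prob_rcons sigma s0 w :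
  (\esum_(t in [set: S]) (cylinder_prob sigma s0 (rcons w t))%:E =
   (cylinder_prob sigma s0 w)%:E)%E.
Proof.
case: w => [|s w] /=.
  rewrite -(@esum_set1 R _ s0 (fun=> 1%:E)) ?lee_fin//.
  rewrite [RHS]esum_mkcond; apply: eq_esum => t _.
  rewrite mulr1; case: eqP => [->|ts]; first by rewrite mem_set.
  by rewrite memNset.
under eq_esum do rewrite path_prob_rcons mulrA.
rewrite esumZ_EFin ?mulr_ge0 ?path_prob_ge0//; last first.
  by have [] := transition_distribution sigma ([::] ++ belast s w) (last s w).
have [_ -> _] := transition_distribution sigma ([::] ++ belast s w) (last s w).
by rewrite mule1.
Qed.

Lemma run_measure_exists (sigma : strategy) (s0 : S) :
  {mu : probability (runspace s0) R |
    forall w, mu (cylinder w) = (cylinder_prob sigma s0 w)%:E}.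
Proof.
apply: sequence_measure_exists => // w.
- exact: cylinder_prob_ge0.
- exact: cylinder_prob_rcons.
Qed.

Definition run_measure (sigma : strategy) (s0 : S) :
  probability (runspace s0) R := sval (run_measure_exists sigma s0).

Lemma run_measure_cylinder sigma s0 w :
  run_measure sigma s0 (cylinder w) = (cylinder_prob sigma s0 w)%:E.
Proof. exact: (svalP (run_measure_exists sigma s0)). Qed.

Definition value (phi : set (nat -> S)) (s : S) : \bar R :=
  ereal_sup [set run_measure sigma s phi | sigma in [set: strategy]].

Definition run : set (nat -> S) := [set x | forall n, step M (x n) (x n.+1)].

Definition transience : set (nat -> S) :=
  [set x | run x /\ forall s, finite_set [set n | x n = s]].

Definition inf_colors (k : nat) (Col : S -> 'I_k) (x : nat -> S) : set 'I_k :=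
  [set c | infinite_set [set n | Col (x n) = c]].

Definition parity (k : nat) (Col : S -> 'I_k) : set (nat -> S) :=
  [set x | run x /\ exists c, [/\ inf_colors Col x c,
    forall c', inf_colors Col x c' -> (c' <= c)%N & ~~ odd c]].

Definition universally_transient : Prop :=
  forall (s0 : S) (sigma : strategy), run_measure sigma s0 transience = 1%E.

Lemma measurable_run (s0 : S) : measurable (run : set (runspace s0)).
Proof.
rewrite (_ : run = \bigcap_n
    [set x | [set w | step M (nth s0 w n) (nth s0 w n.+1)] (mkseq x n.+2)]).
  by apply: bigcapT_measurable => n; exact: measurable_prefix.
apply/seteqP; split => [x h n _|x h n].
  by rewrite /mkset !nth_mkseq//; exact: h.
by have := h n Logic.I; rewrite /mkset !nth_mkseq.
Qed.

Lemma measurable_transience (s0 : S) :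
  measurable (transience : set (runspace s0)).
Proof.
rewrite (_ : transience = run `&`
    ~` \bigcup_s [set x | infinite_set [set n | x n = s]]).
  apply: measurableI; first exact: measurable_run.
  apply: measurableC; apply: countable_bigcupT_measurable => [|s].
    exact: countableP.
  exact: (measurable_infinitely_often (s0 := s0) [set s]).
apply/seteqP; split => x [rx h]; split => //.
  by move=> [s _]; apply; exact: h.
by move=> s; apply: contrapT => ?; apply: h; exists s.
Qed.

Lemma measurable_parity (k : nat) (Col : S -> 'I_k) (s0 : S) :
  measurable (parity Col : set (runspace s0)).
Proof.
have mi c : measurable ([set x | inf_colors Col x c] : set (runspace s0)).
  exact: (measurable_infinitely_often (s0 := s0) [set s | Col s = c]).
rewrite (_ : parity Col = run `&` \bigcup_(c in [set c : 'I_k | ~~ odd c])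
    ([set x | inf_colors Col x c] `&`
     ~` \bigcup_(c' in [set c' : 'I_k | (c < c')%N])
          [set x | inf_colors Col x c'])).
  apply: measurableI; first exact: measurable_run.
  apply: fin_bigcup_measurable => // c _; apply: measurableI => //.
  by apply: measurableC; apply: fin_bigcup_measurable.
apply/seteqP; split => x [rx p]; split => //.
  case: p => c [ic mc oc]; exists c => //; split => // -[c' /= + ic'].
  by rewrite ltnNge mc.
case: p => c oc [ic h]; exists c; split => // c' ic'.
by rewrite leqNgt; apply/negP => cc'; apply: h; exists c'.
Qed.

End mdp.

(* Main.v *)
Require Import Defs.
From HB Require Import structures.
From mathcomp Require Import all_boot all_order all_algebra.
From mathcomp Require Import all_classical all_reals all_analysis.
From mathcomp Require Import lra.

(* Universal transience forces the probability of returning to a state x, over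
   all strategies, to be bounded away from 1; otherwise chaining ever better
   returns would visit x infinitely often.  Summing the resulting hitting
   potentials with small weights gives a bounded function Lam which decreases at
   every controlled state s by at least some lam s > 0, whatever the move: a
   player may give up lam s at each visit to s at a small total cost.

   A run satisfies the co-Buchi objective iff it visits finitely many color-1
   positions, hence only color-1 states in some finite set F; conversely, by
   transience, avoiding the color-1 states outside of F is sufficient.  So the
   value is a supremum, over the finite sets F, of values of safety objectives,
   for which a strategy greedy up to lam is nearly optimal.  These memoryless
   strategies are combined into a uniform one by fixing, for one state after the
   other, the choices on the region where the current strategy is good.

   Working with losses, i.e. 1 minus the value, keeps all sums nonnegative. *)

Import Order.TTheory GRing.Theory Num.Theory.

Local Open Scope classical_set_scope.
Local Open Scope ring_scope.

Set Implicit Arguments.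
Unset Strict Implicit.
Unset Printing Implicit Defensive.

(** * Expectations *)

Section expectation.
Context (R : realType) (S : countType).
Implicit Types (d f g : S -> R) (A : set S) (c e : R).

Definition expect d f : \bar R := (\esum_(t in [set: S]) (d t * f t)%:E)%E.

Lemma expect_ge0 d f : (forall t, 0 <= d t) -> (forall t, 0 <= f t) ->
  (0 <= expect d f)%E.
Proof. by move=> d0 f0; apply: esum_ge0 => t _; rewrite lee_fin mulr_ge0. Qed.

Lemma le_expect d f g : (forall t, 0 <= d t) ->
  (forall t, d t != 0 -> f t <= g t) -> (expect d f <= expect d g)%E.
Proof.
move=> d0 fg; apply: le_esum => t _; rewrite lee_fin.
have [->|dt] := eqVneq (d t) 0; first by rewrite !mul0r.
by rewrite ler_wpM2l// fg.
Qed.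

Lemma expectD d f g : (forall t, 0 <= d t) -> (forall t, 0 <= f t) ->
  (forall t, 0 <= g t) ->
  expect d (fun t => f t + g t) = (expect d f + expect d g)%E.
Proof.
move=> d0 f0 g0; rewrite /expect -esumD.
- by apply: eq_esum => t _; rewrite mulrDr EFinD.
- by move=> t _; rewrite lee_fin mulr_ge0.
- by move=> t _; rewrite lee_fin mulr_ge0.
Qed.

Lemma expectZ d f c : 0 <= c -> (forall t, 0 <= d t) -> (forall t, 0 <= f t) ->
  expect d (fun t => c * f t) = (c%:E * expect d f)%E.
Proof.
move=> c0 d0 f0; rewrite /expect -esumZ_EFin// => [|t]; last exact: mulr_ge0.
by apply: eq_esum => t _; rewrite mulrCA.
Qed.

Lemma expect_cst A d c : is_distribution A d -> 0 <= c ->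
  expect d (fun=> c) = c%:E.
Proof.
case=> d0 d1 _ c0; rewrite /expect.
under eq_esum do rewrite mulrC.
by rewrite esumZ_EFin// d1 mule1.
Qed.

Lemma expect_le_cst A d f c : is_distribution A d -> 0 <= c ->
  (forall t, d t != 0 -> f t <= c) -> (expect d f <= c%:E)%E.
Proof.
move=> dd c0 fc; rewrite -(expect_cst dd c0); apply: le_expect => //.
by case: dd.
Qed.

Lemma expect_ge_cst A d f c : is_distribution A d -> 0 <= c ->
  (forall t, d t != 0 -> c <= f t) -> (c%:E <= expect d f)%E.
Proof.
move=> dd c0 fc; rewrite -(expect_cst dd c0); apply: le_expect => //.
by case: dd.
Qed.

Lemma expect_fin A d f c : is_distribution A d ->
  (forall t, 0 <= f t <= c) -> expect d f \is a fin_num.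
Proof.
move=> dd fc; have [d0 _ _] := dd.
rewrite ge0_fin_numE; last first.
  by apply: expect_ge0 => // t; have /andP[] := fc t.
have c0 : 0 <= `|c| by [].
apply: le_lt_trans (ltry `|c|); apply: expect_le_cst dd c0 _ => t _.
by have /andP[_ /le_trans] := fc t; apply; exact: ler_norm.
Qed.

(** Derandomisation: if every successor of positive weight had a value above [c + e], the average
    would be at least [c + e]. *)
Lemma expect_exists_le A d f c e : is_distribution A d -> 0 <= c -> 0 < e ->
  (expect d f <= c%:E)%E -> exists2 t, A t & f t <= c + e.
Proof.
move=> dd c0 e0 fc; have [_ _ dA] := dd; apply: contrapT => no.
have ce0 : 0 <= c + e by lra.
have /le_trans/(_ fc) : ((c + e)%:E <= expect d f)%E.
  apply: expect_ge_cst dd ce0 _ => t /dA At; rewrite leNgt; apply/negP => h.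
  by apply: no; exists t => //; exact: ltW.
by rewrite lee_fin; lra.
Qed.

Lemma expect_dirac f a : 0 <= f a ->
  expect (fun t => (t == a)%:R) f = (f a)%:E.
Proof.
move=> fa0; rewrite -(@esum_set1 R S a (fun t => (f t)%:E)) ?lee_fin//.
rewrite [RHS]esum_mkcond; apply: eq_esum => t _.
case: (eqVneq t a) => [->|/eqP ta]; first by rewrite mem_set ?mul1r.
by rewrite memNset ?mul0r.
Qed.

Lemma dirac_distribution A a : A a -> is_distribution A (fun t => (t == a)%:R : R).
Proof.
move=> Aa; split.
- by move=> t; rewrite ler0n.
- have := @expect_dirac (fun=> 1) a ler01.
  by rewrite /expect; under eq_esum do rewrite mulr1.
- by move=> t; case: (eqVneq t a) => [->//|]; rewrite eqxx.
Qed.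

(** Monotone convergence in the form used here: a finite partial sum involves finitely many points,
    so by monotonicity a single index [m] approximates [f] up to [e] at all of them. *)
Lemma expect_monotone_le A d f (F : nat -> S -> R) (c : \bar R) : is_distribution A d ->
  (forall t, {homo F^~ t : n m / (n <= m)%N >-> n <= m}) ->
  (forall n t, 0 <= F n t) ->
  (forall t e, 0 < e -> exists n, f t <= F n t + e) ->
  (forall n, (expect d (F n) <= c)%E) -> (expect d f <= c)%E.
Proof.
move=> dd Fnd F0 fF Fc; have [d0 _ _] := dd.
apply/lee_addgt0Pr => e e0; apply: ge_ereal_sup => _ [X [finX _] <-].
have /choice[N NP] : forall t, exists n, f t <= F n t + e by move=> t; exact: fF.
rewrite (@fsbig_finite _ _ _ _ X)//=.
set r := (X in \big[_/_]_(_ <- X) _).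
pose m := (\max_(t <- r) N t)%N.
have h : (\sum_(t <- r) (d t * f t)%:E <= \sum_(t <- r) (d t * (F m t + e))%:E)%E.
  rewrite big_seq [leRHS]big_seq; apply: lee_sum => t tr; rewrite lee_fin.
  rewrite ler_wpM2l//; apply: le_trans (NP t) _; rewrite lerD2r.
  by apply: Fnd; apply: leq_bigmax_seq.
apply: (le_trans h); apply: (@le_trans _ _ (expect d (fun t => F m t + e))).
  apply: esum_ge; exists X => //.
  by rewrite (@fsbig_finite _ _ _ _ X).
by rewrite expectD// ?(expect_cst dd (ltW e0)) ?leeD2r// => t; exact: ltW.
Qed.

(** The decreasing case, obtained from the increasing one for [1 - f] and [1 - F n]. *)
Lemma expect_monotone_ge A d f (F : nat -> S -> R) c : is_distribution A d ->
  (forall t, {homo F^~ t : n m / (n <= m)%N >-> m <= n}) ->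
  (forall n t, 0 <= F n t <= 1) -> (forall t, 0 <= f t <= 1) ->
  (forall t e, 0 < e -> exists n, F n t <= f t + e) ->
  (forall n, (c%:E <= expect d (F n))%E) -> (c%:E <= expect d f)%E.
Proof.
move=> dd Fni F01 f01 fF Fc; have [d0 _ _] := dd.
have compl g : (forall t, 0 <= g t <= 1) ->
    (expect d (fun t => 1 - g t)%R + expect d g = 1)%E.
  move=> g01; rewrite -expectD//; last 2 first.
    by move=> t; have := g01 t; lra.
    by move=> t; have := g01 t; lra.
  rewrite -(expect_cst dd ler01); congr expect; apply/funext => t; lra.
have : (expect d (fun t => 1 - f t)%R <= 1 - c%:E)%E.
  apply: (@expect_monotone_le A _ _ (fun n t => 1 - F n t)) => //.
  - by move=> t n m nm; have := Fni t _ _ nm; lra.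
  - by move=> n t; have := F01 n t; lra.
  - by move=> t e /fF-/(_ t)[n Fn]; exists n; move: Fn; lra.
  - move=> n; rewrite leeBrDr// -(compl _ (F01 n)) leeD2l//.
rewrite leeBrDr// -(compl _ f01).
rewrite leeD2lE//; apply: (@expect_fin A _ _ 1) => // t; have := f01 t; lra.
Qed.

End expectation.

(** * Run measures *)

Section run_measures.
Context (R : realType) (S : countType).

Lemma cylinder_rconsE (w : seq S) (t : S) (x : nat -> S) :
  cylinder (rcons w t) x <-> cylinder w x /\ x (size w) = t.
Proof.
rewrite /cylinder /= size_rcons mkseqS; split => [/rcons_inj[]//|[-> ->//]].
Qed.

Lemma measurable_cylinder (s0 : S) (w : seq S) :
  measurable (cylinder w : set (runspace s0)).
Proof. by apply: sub_sigma_algebra; exists w. Qed.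

Lemma measure_cylinder_split (s0 : S) (mu : probability (runspace s0) R)
    (w : seq S) (A : set (runspace s0)) : measurable A ->
  mu (cylinder w `&` A) =
    (\esum_(t in [set: S]) mu (cylinder (rcons w t) `&` A))%E.
Proof.
move=> mA.
pose G n : set (runspace s0) :=
  if @pickle_inv S n is Some t then cylinder (rcons w t) `&` A else set0.
have mG n : measurable (G n).
  rewrite /G; case: pickle_inv => [t|]; last exact: measurable0.
  by apply: measurableI => //; exact: measurable_cylinder.
have GE : cylinder w `&` A = \bigcup_n G n.
  apply/seteqP; split => [x [wx Ax]|x [n _]].
    exists (pickle (x (size w))) => //; rewrite /G pickleK_inv; split => //.
    exact/cylinder_rconsE.
  by rewrite /G; case: pickle_inv => // t [/cylinder_rconsE[]].
have tG : trivIset setT G.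
  move=> i j _ _ [x []]; rewrite /G.
  case Ei : (pickle_inv i) => [t|//]; case Ej : (pickle_inv j) => [u|//].
  move=> [/cylinder_rconsE[_ xt] _] [/cylinder_rconsE[_ xu] _].
  have := @pickle_invK S i; have := @pickle_invK S j.
  by rewrite Ei Ej /= => <- <-; rewrite -xt -xu.
rewrite GE measure_semi_bigcup//; last exact: bigcup_measurable.
rewrite nneseries_esumT//.
have -> : (\esum_(t in [set: S]) mu (cylinder (rcons w t) `&` A) =
    \esum_(t in [set: S]) mu (G (pickle t)))%E.
  by apply: eq_esum => t _; rewrite /G pickleK_inv.
rewrite -(@esum_image R S nat setT (@pickle S) (fun n => mu (G n))).
  rewrite [LHS]esum_mkcond [RHS]esum_mkcond; apply: eq_esum => n _.
  rewrite in_setT; case: ifPn => // /negP nr; rewrite /G.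
  case E : (pickle_inv n) => [t|]; last exact: measure0.
  exfalso; apply: nr; rewrite inE; exists t => //.
  by have := @pickle_invK S n; rewrite /oapp E.
by move=> s t _ _ /(pcan_inj (@pickleK S)).
Qed.

Lemma measure_nondecreasing_bigcup_le (s0 : S)
    (mu : probability (runspace s0) R) (F : nat -> set (runspace s0)) (c : \bar R) :
  (forall n, measurable (F n)) -> nondecreasing_seq F ->
  (forall n, (mu (F n) <= c)%E) -> (mu (\bigcup_n F n) <= c)%E.
Proof.
move=> mF ndF Fc; have mU : measurable (\bigcup_n F n) by exact: bigcup_measurable.
have h := nondecreasing_cvg_mu (mu := mu) mF mU ndF.
rewrite -(cvg_lim _ h)//; apply: lime_le; first by apply/cvg_ex; eexists; exact: h.
by apply: nearW => n; exact: Fc.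
Qed.

Context (M : mdp R S) (sigma : strategy M) (s0 : S).
Local Notation mu := (run_measure sigma s0).

Lemma cylinder_prob_rcons2 rho s t :
  cylinder_prob sigma s0 (rcons (rcons rho s) t) =
  cylinder_prob sigma s0 (rcons rho s) * transition sigma rho s t.
Proof.
case: rho => [|a r] /=; first by rewrite !mulr1.
by rewrite path_prob_rcons mulrA belast_rcons last_rcons.
Qed.

Lemma run_measure_init (A : set (runspace s0)) : measurable A ->
  mu A = mu (cylinder [:: s0] `&` A).
Proof.
move=> mA; transitivity (mu (cylinder [::] `&` A)).
  by congr (mu _); apply/seteqP; split => [x|x []].
rewrite measure_cylinder_split//.
rewrite -(@esum_set1 R S s0 (fun t => mu (cylinder [:: t] `&` A)))//.
rewrite [RHS]esum_mkcond; apply: eq_esum => t _ /=.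
have [->|/eqP ts] := eqVneq t s0; first by rewrite mem_set.
rewrite memNset//; apply/eqP; rewrite eq_le measure_ge0 andbT.
apply: (@le_trans _ _ (mu (cylinder [:: t]))).
  by apply: le_measure; rewrite ?inE//; [apply: measurableI => //|];
    exact: measurable_cylinder.
by rewrite run_measure_cylinder /=; case: eqP => // _; rewrite mul0r.
Qed.

(** Ville's maximal inequality for a history-dependent nonnegative process. The supermartingale
    condition is only required below level 1, as the process may be stopped once it reaches 1. *)
Lemma ville (W : seq S -> S -> R) : (forall rho s, 0 <= W rho s) ->
  (forall rho s, W rho s < 1 ->
    (expect (transition sigma rho s) (W (rcons rho s)) <= (W rho s)%:E)%E) ->
  (mu [set x | exists n, (1 <= W (mkseq x n) (x n))%R] <= (W [::] s0)%:E)%E.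
Proof.
move=> W0 Wsup.
(* Level 1 is reached within the time window from [k] to [k + n]. *)
pose H n k : set (runspace s0) :=
  [set x | exists2 j, (k <= j <= k + n)%N & 1 <= W (mkseq x j) (x j)].
have mW j : measurable ([set x | 1 <= W (mkseq x j) (x j)] : set (runspace s0)).
  rewrite (_ : [set x | _] = [set x | [set w | 1 <= W (take j w) (nth s0 w j)]
      (mkseq x j.+1)]); first exact: measurable_prefix.
  apply/seteqP; split => x /=.
    by rewrite nth_mkseq// -map_take take_iota (minn_idPl (leqnSn j)).
  by rewrite nth_mkseq// -map_take take_iota (minn_idPl (leqnSn j)).
have mH n k : measurable (H n k).
  rewrite (_ : H n k = \bigcup_(j in [set j | (k <= j <= k + n)%N])
      [set x | 1 <= W (mkseq x j) (x j)]); first exact: bigcup_measurable.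
  by apply/seteqP; split => x [j ? ?]; exists j.
(* The inequality conditioned on each history, by induction on the length of the window: below level
   1 the current time contributes nothing, so the window can start one step later. *)
have key n : forall rho s, (mu (cylinder (rcons rho s) `&` H n (size rho)) <=
    (cylinder_prob sigma s0 (rcons rho s) * W rho s)%:E)%E.
  elim: n => [|n IH] rho s; (have [W1|W1] := leP 1 (W rho s);
    [apply: (@le_trans _ _ (mu (cylinder (rcons rho s))));
       [by apply: le_measure; rewrite ?inE//; [apply: measurableI => //|];
         exact: measurable_cylinder
       |by rewrite run_measure_cylinder lee_fin ler_peMr// cylinder_prob_ge0]|]).
    rewrite (_ : _ `&` _ = set0) ?measure0.
      by rewrite lee_fin mulr_ge0// cylinder_prob_ge0.
    apply/seteqP; split=> // x [/cylinder_rconsE[xr xs] [j]].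
    rewrite addn0 -eqn_leq => /eqP <-; rewrite xs xr; lra.
  have cylH : cylinder (rcons rho s) `&` H n.+1 (size rho) `<=`
      cylinder (rcons rho s) `&` H n (size (rcons rho s)).
    move=> x [xc [j /andP[j1 j2] Wj]]; split => //.
    exists j => //; rewrite size_rcons addSnnS j2 andbT ltn_neqAle j1 andbT.
    apply/eqP => e; move: xc Wj => /cylinder_rconsE[xr xs].
    by rewrite -e xs xr; lra.
  apply: (@le_trans _ _ (mu (cylinder (rcons rho s) `&` H n (size (rcons rho s))))).
    apply: le_measure; rewrite ?inE//;
    by apply: measurableI; rewrite //; exact: measurable_cylinder.
  rewrite measure_cylinder_split//.
  apply: (@le_trans _ _ (\esum_(t in [set: S]) (cylinder_prob sigma s0 (rcons rho s)
     * (transition sigma rho s t * W (rcons rho s) t))%:E)%E).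
    apply: le_esum => t _; rewrite mulrA -cylinder_prob_rcons2; exact: IH.
  have tr0 t : 0 <= transition sigma rho s t.
    by have [] := transition_distribution sigma rho s.
  rewrite esumZ_EFin ?cylinder_prob_ge0//; last by move=> t; exact: mulr_ge0.
  by rewrite EFinM lee_wpmul2l ?lee_fin ?cylinder_prob_ge0// Wsup.
have -> : [set x | exists n, 1 <= W (mkseq x n) (x n)] = \bigcup_n H n 0%N.
  apply/seteqP; split => [x [n Wn]|x [n _ [j _ Wj]]]; last by exists j.
  by exists n => //; exists n => //=.
apply: measure_nondecreasing_bigcup_le => [n|m n mn|n]; first exact: mH.
  apply/subsetPset => x [j /andP[_ j2] Wj]; exists j => //=.
  exact: leq_trans mn.
rewrite run_measure_init//; apply: le_trans (key n [::] s0) _.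
by rewrite /= eqxx !mul1r.
Qed.

End run_measures.

(** * Return probabilities *)

Section lyapunov.
Context (R : realType) (S : countType) (M : mdp R S).
Implicit Types (f g : S -> R) (e : R).

Definition det_choice (g : seq S -> S -> S) (rho : seq S) (s t : S) : R :=
  (t == g rho s)%:R.

Lemma det_choice_distribution (g : seq S -> S -> S) rho s : step M s (g rho s) ->
  is_distribution (step M s) (det_choice g rho s).
Proof. exact: dirac_distribution. Qed.

Definition det_strategy (g : seq S -> S -> S)
    (gM : forall rho s, controlled M s -> step M s (g rho s)) : strategy M :=
  Strategy (fun rho s cs => det_choice_distribution (gM rho s cs)).

Lemma expect_det_strategy (g : seq S -> S -> S)
    (gM : forall rho s, controlled M s -> step M s (g rho s)) rho s f :
  (forall t, 0 <= f t) ->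
  expect (transition (det_strategy gM) rho s) f =
  if controlled M s then (f (g rho s))%:E else expect (prob M s) f.
Proof. by move=> f0; rewrite /transition; case: ifPn => // _; exact: expect_dirac. Qed.

(** The Bellman operator of the maximising player. With infinite branching the supremum need not be
    attained. *)
Definition backup f (s : S) : R :=
  if controlled M s then sup [set f z | z in step M s]
  else fine (expect (prob M s) f).

Lemma backup_prob f s : (forall t, 0 <= f t <= 1) -> ~~ controlled M s ->
  (backup f s)%:E = expect (prob M s) f.
Proof.
move=> f01 cs; rewrite /backup (negbTE cs) fineK//.
exact: expect_fin (prob_distribution cs) f01.
Qed.

Lemma backup_has_sup f s : (forall t, 0 <= f t <= 1) ->
  has_sup [set f z | z in step M s].
Proof.
move=> f01; split.
  by have [z sz] := step_total M s; exists (f z); exists z.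
by exists 1 => _ [z _ <-]; have /andP[] := f01 z.
Qed.

Lemma backup_step f s z : (forall t, 0 <= f t <= 1) -> controlled M s ->
  step M s z -> f z <= backup f s.
Proof.
move=> f01 cs sz; rewrite /backup cs; apply: ub_le_sup; last by exists z.
by have [] := backup_has_sup s f01.
Qed.

Lemma backup_adherent f s e : (forall t, 0 <= f t <= 1) -> controlled M s ->
  0 < e -> exists2 z, step M s z & backup f s - e <= f z.
Proof.
move=> f01 cs e0; rewrite /backup cs.
have [_ [z sz <-] /ltW] := sup_adherent e0 (backup_has_sup s f01).
by exists z.
Qed.

Lemma backup_le f s c : (forall t, 0 <= f t <= 1) -> 0 <= c ->
  (forall t, step M s t -> f t <= c) -> backup f s <= c.
Proof.
move=> f01 c0 fc; have [cs|cs] := boolP (controlled M s).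
  rewrite /backup cs; apply: ge_sup; first by have [] := backup_has_sup s f01.
  by move=> _ [z sz <-]; exact: fc.
rewrite -lee_fin backup_prob//; have dd := prob_distribution cs.
by apply: (expect_le_cst dd) => // t; have [_ _ h] := dd; move=> /h /fc.
Qed.

Lemma backup01 f s : (forall t, 0 <= f t <= 1) -> 0 <= backup f s <= 1.
Proof.
move=> f01; apply/andP; split; last first.
  by apply: backup_le => // t _; have /andP[] := f01 t.
have [cs|cs] := boolP (controlled M s).
  have [z sz] := step_total M s; apply: le_trans (backup_step f01 cs sz).
  by have /andP[] := f01 z.
rewrite -lee_fin backup_prob//; apply: expect_ge0 => t; last by have /andP[] := f01 t.
by have [] := prob_distribution cs.
Qed.

Lemma backup_mono f g s : (forall t, 0 <= f t <= 1) -> (forall t, 0 <= g t <= 1) ->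
  (forall t, f t <= g t) -> backup f s <= backup g s.
Proof.
move=> f01 g01 fg; have [cs|cs] := boolP (controlled M s).
  rewrite {1}/backup cs; apply: ge_sup; first by have [] := backup_has_sup s f01.
  by move=> _ [z sz <-]; apply: le_trans (fg z) _; exact: backup_step.
rewrite -lee_fin !backup_prob//; apply: le_expect => //.
by have [] := prob_distribution cs.
Qed.

(** Value iteration for the optimal probability of visiting [x] within [n] steps. Starting in [x]
    counts as a visit, so a genuine return is measured by [backup (reach x n) x]. *)
Fixpoint reach (x : S) (n : nat) (y : S) : R :=
  if y == x then 1 else if n is n'.+1 then backup (reach x n') y else 0.

Lemma reachS x n y :
  reach x n.+1 y = if y == x then 1 else backup (reach x n) y.
Proof. by []. Qed.

Lemma reach_self x n : reach x n x = 1.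
Proof. by case: n => [|n] /=; rewrite eqxx. Qed.

Lemma reach01 x n y : 0 <= reach x n y <= 1.
Proof.
elim: n y => [|n IH] y /=; case: ifP => // _; rewrite ?lexx ?ler01//.
exact: backup01.
Qed.

Lemma reach_nondecreasing x y : {homo reach x ^~ y : n m / (n <= m)%N >-> n <= m}.
Proof.
apply: homo_leq => // [|n]; first exact: le_trans.
elim: n y => [|n IH] y; rewrite !reachS; case: (boolP (y == x)) => // yx.
- by rewrite /= yx.
- by rewrite /= (negbTE yx); have /andP[] := backup01 y (reach01 x 0).
by apply: backup_mono => // t; exact: reach01.
Qed.

Section infinite_return.
Variables (x : S) (horizon : nat -> nat).
(** The error allowed at time [n], spent at most twice: on the horizon chosen at a visit to [x] and
    on a move that is only nearly optimal. *)
Let slack (n : nat) : R := 2^-1 ^+ n.+3.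
Hypothesis horizonP : forall n, 1 - slack n <= backup (reach x (horizon n)) x.

(* Steps left after the history [rho] for reaching [x] again; each visit to
   [x] resets the deadline. *)
Let remaining (rho : seq S) : nat :=
  (foldl (fun p s => (p.1.+1, if s == x then horizon p.1 else p.2.-1)) (0, 0)%N rho).2.

Let remaining_rcons rho s :
  remaining (rcons rho s) = if s == x then horizon (size rho) else (remaining rho).-1.
Proof.
rewrite /remaining foldl_rcons /=; case: ifP => // _; congr horizon.
by elim/last_ind: rho => // r t IH; rewrite foldl_rcons size_rcons /= IH.
Qed.

Let slack_gt0 n : 0 < slack n. Proof. by rewrite exprn_gt0 ?invr_gt0. Qed.

Let next rho s : S := xget s [set z | step M s z /\
  backup (reach x (remaining (rcons rho s))) s - slack (size rho)
    <= reach x (remaining (rcons rho s)) z].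

Let nextP rho s : controlled M s -> step M s (next rho s) /\
  backup (reach x (remaining (rcons rho s))) s - slack (size rho)
    <= reach x (remaining (rcons rho s)) (next rho s).
Proof.
move=> cs; rewrite /next; case: xgetP => [//|no]; exfalso.
have [z sz zb] := backup_adherent (reach01 x (remaining (rcons rho s))) cs
  (slack_gt0 (size rho)).
by have := no z; apply; split.
Qed.

Let next_step rho s : controlled M s -> step M s (next rho s).
Proof. by move=> /(nextP rho)[]. Qed.

(* If [x] could be revisited with probability arbitrarily close to 1, playing
   for ever closer returns would visit [x] infinitely often with probability at
   least 1/2. *)
Lemma infinite_return : universally_transient M -> False.
Proof.
move=> UT; pose sigma := det_strategy next_step.
(* The sum of [2 * slack k] over all [k >= n]: what may still be lost from time [n] on. *)
pose budget n : R := 2^-1 ^+ n.+1.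
have budgetE n : budget n = 2 * slack n + budget n.+1.
  by rewrite /budget /slack !exprS; lra.
have budget_gt0 n : 0 < budget n by rewrite exprn_gt0 ?invr_gt0.
(* The probability of missing the current deadline under optimal play, plus all errors still to
   come. *)
pose W rho s : R := Num.min 1 (1 - reach x (remaining rho) s + budget (size rho)).
have W0 rho s : 0 <= W rho s.
  rewrite /W le_min ler01 /=; have := reach01 x (remaining rho) s.
  by have := budget_gt0 (size rho); lra.
have drift rho s : (expect (transition sigma rho s) (W (rcons rho s)) <=
    (1 - backup (reach x (remaining (rcons rho s))) s + slack (size rho)
       + budget (size rho).+1)%:E)%E.
  rewrite expect_det_strategy//; case: ifPn => cs.
    have [_ h] := nextP rho cs; rewrite lee_fin /W ge_min size_rcons.
    by apply/orP; right; move: h; lra.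
  set m := remaining _; set b := budget _.
  have b0 : 0 < b by exact: budget_gt0.
  have dd := prob_distribution cs; have [p0 _ _] := dd.
  have m01 := reach01 x m.
  have : (expect (prob M s) (fun t => 1 - reach x m t + b)%R +
          expect (prob M s) (reach x m) = (1 + b)%:E)%E.
    rewrite -expectD//; last 2 first.
      by move=> t; have := m01 t; lra.
      by move=> t; have := m01 t; lra.
    rewrite -(expect_cst (c := 1 + b) dd); last by lra.
    by congr expect; apply/funext => t; lra.
  rewrite -(backup_prob (reach01 x m) cs) => /(congr1 (fun z => z - (backup (reach x m) s)%:E))%E.
  rewrite addeK// => EE.
  have : (expect (prob M s) (W (rcons rho s)) <=
          expect (prob M s) (fun t => 1 - reach x m t + b)%R)%E.
    apply: le_expect => // t _; rewrite /W ge_min; apply/orP; right.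
    by rewrite size_rcons lexx.
  move=> /le_trans; apply; rewrite EE -EFinB lee_fin.
  by have := slack_gt0 (size rho); lra.
have Wsup rho s : W rho s < 1 ->
    (expect (transition sigma rho s) (W (rcons rho s)) <= (W rho s)%:E)%E.
  move=> W1; apply: le_trans (drift rho s) _; rewrite lee_fin.
  have W2 : W rho s = 1 - reach x (remaining rho) s + budget (size rho).
    by move: W1; rewrite /W gt_min ltxx /= => /ltW /min_idPr.
  move: W1; rewrite W2 remaining_rcons (budgetE (size rho)).
  have := slack_gt0 (size rho); have := budget_gt0 (size rho).+1.
  have [->|sx] := eqVneq s x.
    by rewrite reach_self => ? ?; have := horizonP (size rho); lra.
  (* With no step left away from [x], [reach] is 0 and [W] is not below 1; otherwise [reach] unfolds
     to the [backup] appearing in [drift]. *)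
  by case: (remaining rho) => [|m] /=; rewrite (negbTE sx); lra.
have h := @ville R S M sigma x W W0 Wsup.
(* The run starts in [x], where [reach] is 1 whatever the deadline, so only [budget 0] is left. *)
have Wx : W [::] x <= 2^-1.
  by rewrite /W reach_self subrr add0r ge_min /budget expr1 lexx orbT.
have : (run_measure sigma x (transience M) <= (2^-1)%:E)%E.
  apply: (@le_trans _ _ (run_measure sigma x
     [set y | exists n, 1 <= W (mkseq y n) (y n)]%R)).
    apply: le_measure; rewrite ?inE; first exact: measurable_transience.
      rewrite (_ : [set y | _] = \bigcup_n [set y | [set w |
          1 <= W (take n w) (nth x w n)] (mkseq y n.+1)]).
        by apply: bigcupT_measurable => n; exact: measurable_prefix.
      apply/seteqP; split => y /=.
        move=> [n Wn]; exists n => //=.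
        by rewrite nth_mkseq// -map_take take_iota (minn_idPl (leqnSn n)).
      move=> [n _ /=]; rewrite nth_mkseq// -map_take take_iota (minn_idPl (leqnSn n)).
      by exists n.
    (* After the last visit to [x] the deadline is no longer reset and counts down to 0 away from
       [x], which brings [W] to 1. *)
    move=> y [_ /(_ x) /finite_seqP[r rE]].
    pose k := (\max_(i <- r) i).+1.
    have yk n : (k <= n)%N -> y n != x.
      move=> kn; apply/eqP => ynx.
      have nr : n \in r by move: (ynx : [set n | y n = x] n); rewrite rE.
      have := @leq_bigmax_seq _ _ xpredT id _ nr isT.
      by rewrite leqNgt => /negP; apply; exact: kn.
    have rem i : (remaining (mkseq y (k + i)) <= remaining (mkseq y k) - i)%N.
      elim: i => [|i IH]; first by rewrite addn0 subn0.
      rewrite addnS mkseqS remaining_rcons (negbTE (yk _ (leq_addr _ _))).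
      by rewrite subnS; case: (remaining _) IH => [|m] //=; case: (_ - i)%N.
    exists (k + remaining (mkseq y k))%N.
    have := rem (remaining (mkseq y k)); rewrite subnn leqn0 => /eqP re.
    rewrite /W re le_min lexx /= (negbTE (yk _ (leq_addr _ _))).
    by have := budget_gt0 (size (mkseq y (k + remaining (mkseq y k)))); lra.
  by apply: le_trans h _; rewrite lee_fin.
by rewrite UT lee_fin; lra.
Qed.

End infinite_return.

Lemma return_bound x : universally_transient M ->
  exists2 e, 0 < e & forall n, backup (reach x n) x <= 1 - e.
Proof.
move=> UT; apply: contrapT => no.
have /choice[N NP] : forall n, exists m, 1 - 2^-1 ^+ n.+3 <= backup (reach x m) x.
  move=> n; apply: contrapT => noN; apply: no.
  exists (2^-1 ^+ n.+3); first by rewrite exprn_gt0 ?invr_gt0.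
  move=> m; rewrite leNgt; apply/negP => /ltW h; apply: noN; by exists m.
exact: infinite_return NP UT.
Qed.

End lyapunov.

(** * Lyapunov functions *)

Section lyapunov_function.
Context (R : realType) (S : countType) (M : mdp R S).
Hypothesis UT : universally_transient M.

(** [G] is the optimal probability of ever visiting [x]. It equals 1 at [x], but by [return_bound]
    it is at most [1 - c] after a controlled move from [x]; away from [x] the recursion for [reach]
    shows that no move increases it. *)
Lemma hitting_potential x : exists (c : R) (G : S -> R),
  [/\ 0 < c, forall y, 0 <= G y <= 1,
      forall y z, controlled M y -> step M y z -> G z + c * (y == x)%:R <= G y
    & forall y, ~~ controlled M y -> (expect (prob M y) G <= (G y)%:E)%E].
Proof.
have [c c0 hc] := return_bound x UT.
pose G y : R := sup (range (fun n => reach M x n y)).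
have hs y : has_sup (range (fun n => reach M x n y)).
  split; first by exists (reach M x 0 y); exists 0%N.
  by exists 1 => _ [n _ <-]; have /andP[] := reach01 M x n y.
have reachG n y : reach M x n y <= G y.
  by apply: ub_le_sup; [have [] := hs y|exists n].
have G01 y : 0 <= G y <= 1.
  apply/andP; split; first by have /andP[h _] := reach01 M x 0 y; exact: le_trans h _.
  apply: ge_sup; first by have [] := hs y.
  by move=> _ [n _ <-]; have /andP[] := reach01 M x n y.
have Gx : G x = 1.
  apply/eqP; rewrite eq_le; have /andP[_ ->] := G01 x.
  by rewrite -(reach_self M x 0) reachG.
exists c, G; split => // [y z cy yz|y cy].
  have [yx|yx] := eqVneq y x.
    rewrite {}yx in cy yz *; rewrite Gx mulr1 -lerBrDr; apply: ge_sup; first by have [] := hs z.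
    move=> _ [n _ <-]; apply: le_trans (hc n).
    by apply: backup_step => //; exact: reach01.
  rewrite mulr0 addr0; apply: ge_sup; first by have [] := hs z.
  move=> _ [n _ <-]; apply: le_trans (reachG n.+1 y).
  by rewrite reachS (negbTE yx); apply: backup_step => //; exact: reach01.
have dd := prob_distribution cy.
have [yx|yx] := eqVneq y x.
  by rewrite {}yx in dd *; rewrite Gx; apply: expect_le_cst dd _ _ => // t _; have /andP[] := G01 t.
apply: (expect_monotone_le (F := reach M x) dd) => [t|n t|t e e0|n].
- exact: reach_nondecreasing.
- by have /andP[] := reach01 M x n t.
- have [_ [n _ <-] h] := sup_adherent e0 (hs t).
  by exists n; move: h; rewrite -/(G t); lra.
- rewrite -backup_prob//; last exact: reach01.
  by rewrite lee_fin; apply: le_trans (reachG n.+1 y); rewrite reachS (negbTE yx).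
Qed.

(* The weighted sum of the hitting potentials of all states. *)
Lemma lyapunov_exists (eps : R) : 0 < eps -> exists lam Lam : S -> R,
  [/\ forall y, 0 < lam y, forall y, 0 <= Lam y <= eps,
      forall y z, controlled M y -> step M y z -> Lam z + lam y <= Lam y
    & forall y, ~~ controlled M y -> (expect (prob M y) Lam <= (Lam y)%:E)%E].
Proof.
move=> eps0.
have /choice[c /choice[G GP]] := hitting_potential.
(* Weights of total [eps]; the potential of the state with code [n] gets weight [a n]. *)
pose a n : R := eps * 2^-1 ^+ n.+1.
have half0 n : 0 < 2^-1 ^+ n :> R by rewrite exprn_gt0 ?invr_gt0.
have a0 n : 0 < a n by rewrite mulr_gt0.
pose g n y : R := if @pickle_inv S n is Some x then G x y else 0.
have g01 n y : 0 <= g n y <= 1.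
  by rewrite /g; case: pickle_inv => [x|]; [have [] := GP x|rewrite lexx ler01].
have ag0 n y : 0 <= a n * g n y.
  by apply: mulr_ge0; [exact: ltW|have /andP[] := g01 n y].
pose F n y := \sum_(k < n) a k * g k y.
have FS n y : F n.+1 y = F n y + a n * g n y by rewrite /F big_ord_recr.
have Fge0 n y : 0 <= F n y by exact: sumr_ge0.
have Fle n y : F n y <= eps * (1 - 2^-1 ^+ n).
  elim: n => [|n IH]; first by rewrite /F big_ord0 expr0 subrr mulr0.
  rewrite FS; apply: (le_trans (lerD IH (_ : _ <= a n))).
    by rewrite ler_piMr ?(ltW (a0 n))//; have /andP[] := g01 n y.
  by rewrite /a -mulrDr ler_wpM2l ?(ltW eps0)// exprS; lra.
have Feps n y : F n y <= eps.
  apply: (le_trans (Fle n y)); apply: ler_piMr; first exact: ltW.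
  by have := half0 n; lra.
have Fnd y : {homo F ^~ y : n m / (n <= m)%N >-> n <= m}.
  by apply: homo_leq => // [|n]; [exact: le_trans|rewrite FS lerDl].
pose Lam y := sup (range (F ^~ y)).
have hs y : has_sup (range (F ^~ y)).
  by split; [exists (F 0%N y); exists 0%N|exists eps => _ [n _ <-]].
have FLam n y : F n y <= Lam y by apply: ub_le_sup; [have [] := hs y|exists n].
(* The strict decrease at [y] comes from one summand, the potential of [y] itself, present once [n]
   exceeds [pickle y]. *)
have FstepS n y z : controlled M y -> step M y z ->
    F n z + (if (pickle y < n)%N then a (pickle y) * c y else 0) <= F n y.
  move=> cy yz; elim: n => [|n IH]; first by rewrite /F !big_ord0 addr0.
  have gn : g n z + (if n == pickle y then c y else 0) <= g n y.
    rewrite /g; case E : (pickle_inv n) => [x|]; last first.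
      case: eqP => [ny|_]; last by rewrite addr0.
      by move: E; rewrite ny pickleK_inv.
    have nx : n = pickle x by have := @pickle_invK S n; rewrite E.
    have [_ _ /(_ y z cy yz) + _] := GP x.
    rewrite nx (inj_eq (pcan_inj (@pickleK S))) eq_sym.
    by case: eqP => [->|_]; rewrite ?mulr1 ?mulr0.
  have agn := ler_wpM2l (ltW (a0 n)) gn; rewrite !FS ltnS leq_eqVlt.
  move: IH agn; rewrite mulrDr eq_sym; case: eqP => [<-|_] /=.
    by rewrite ltnn; lra.
  by rewrite mulr0; lra.
exists (fun y => a (pickle y) * c y), Lam; split.
- by move=> y; rewrite mulr_gt0//; have [] := GP y.
- move=> y; rewrite (le_trans (Fge0 0%N y) (FLam 0%N y)) /=.
  by apply: ge_sup; [have [] := hs y|move=> _ [n _ <-]].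
- move=> y z cy yz; rewrite -lerBrDr; apply: ge_sup; first by have [] := hs z.
  move=> _ [n _ <-]; rewrite lerBrDr; pose m := maxn n (pickle y).+1.
  apply: (@le_trans _ _ (F m z + a (pickle y) * c y)).
    by rewrite lerD2r; apply: Fnd; exact: leq_maxl.
  have := FstepS m _ _ cy yz; rewrite leq_maxr => /le_trans; apply; exact: FLam.
- move=> y cy; have dd := prob_distribution cy; have [p0 _ _] := dd.
  apply: (expect_monotone_le (F := F) dd) => // [t e e0|n].
    have [_ [n _ <-] h] := sup_adherent e0 (hs t).
    by exists n; move: h; rewrite -/(Lam t); lra.
  apply: (@le_trans _ _ (F n y)%:E); last by rewrite lee_fin.
  elim: n => [|n IH].
    apply: expect_le_cst dd (Fge0 _ _) _ => t _.
    by rewrite /F !big_ord0.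
  have -> : F n.+1 = (fun t => F n t + a n * g n t) by apply/funext => t.
  rewrite expectD// expectZ ?(ltW (a0 n))//; last by move=> t; have /andP[] := g01 n t.
  rewrite EFinD; apply: leeD => //; rewrite [leRHS]EFinM.
  apply: lee_wpmul2l; first by rewrite lee_fin ltW.
  rewrite /g; case: pickle_inv => [x|].
    by have [_ _ _] := GP x; apply.
  exact: expect_le_cst dd _ _.
Qed.

End lyapunov_function.

(** * Losses *)

Section losses.
Context (R : realType) (S : countType) (M : mdp R S) (B : set S).
Implicit Types (al : S -> set S) (l : S -> R).

(* The move relation [al] restricts the choices at controlled states, and [l]
   bounds from below the probability of visiting [B] outside of the finite set
   of states of code less than [n]. *)
Definition safe_loss al (n : nat) l : Prop :=
  [/\ forall s, 0 <= l s <= 1,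
      forall s, B s -> (n <= pickle s)%N -> l s = 1,
      forall s e, controlled M s -> 0 < e -> exists2 z, al s z & l z <= l s + e
    & forall s, ~~ controlled M s -> (expect (prob M s) l <= (l s)%:E)%E].

Lemma safe_loss1 al n : (forall s, al s !=set0) -> safe_loss al n (fun=> 1).
Proof.
move=> al0; split=> // [s|s e cs e0|s cs]; first by rewrite ler01 lexx.
  by have [z sz] := al0 s; exists z => //; rewrite lerDl ltW.
by rewrite (expect_cst (prob_distribution cs)).
Qed.

Definition minloss al n s : R := inf [set l s | l in safe_loss al n].

Lemma minloss_le al n l s : safe_loss al n l -> minloss al n s <= l s.
Proof.
move=> sl; apply: ge_inf; last by exists l.
by exists 0 => _ [l' [l01 _ _ _] <-]; have /andP[] := l01 s.
Qed.

Section nonempty.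
Context (al : S -> set S).
Hypothesis al0 : forall s, al s !=set0.

Let hinf n s : has_inf [set l s | l in safe_loss al n].
Proof.
split; first by exists 1, (fun=> 1) => //; exact: safe_loss1.
by exists 0 => _ [l' [l01 _ _ _] <-]; have /andP[] := l01 s.
Qed.

Lemma le_minloss n s c : (forall l, safe_loss al n l -> c <= l s) ->
  c <= minloss al n s.
Proof.
move=> h; apply: lb_le_inf; first by have [] := hinf n s.
by move=> _ [l sl <-]; exact: h.
Qed.

Lemma minloss_adherent n s e : 0 < e ->
  exists2 l, safe_loss al n l & l s <= minloss al n s + e.
Proof.
move=> e0; have [_ [l sl <-] /ltW] := inf_adherent e0 (hinf n s).
by exists l.
Qed.

(** All clauses of [safe_loss] survive pointwise infima. At controlled states half of [e] pays for
    approaching the infimum and half for the move. *)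
Lemma minloss_safe n : safe_loss al n (minloss al n).
Proof.
have l01 s : 0 <= minloss al n s <= 1.
  apply/andP; split; first by apply: le_minloss => l [l01 _ _ _]; have /andP[] := l01 s.
  by rewrite (@minloss_le al n (fun=> 1)) //; exact: safe_loss1.
split=> // [s Bs ns|s e cs e0|s cs].
- apply/eqP; rewrite eq_le; have /andP[_ ->] := l01 s.
  by apply: le_minloss => l [_ lB _ _]; rewrite lB.
- have e20 : 0 < e / 2 by lra.
  have [l sl ls] := minloss_adherent n s e20.
  have [_ _ /(_ s _ cs e20)[z sz lz] _] := sl.
  by exists z => //; have := minloss_le z sl; lra.
- have dd := prob_distribution cs; have [p0 _ _] := dd.
  have fin : expect (prob M s) (minloss al n) \is a fin_num.
    exact: expect_fin dd l01.
  rewrite -(fineK fin) lee_fin; apply: le_minloss => l sl.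
  have [_ _ _ h] := sl; rewrite -lee_fin fineK//; apply: le_trans (h _ cs).
  by apply: le_expect => // t _; exact: minloss_le.
Qed.

Lemma minloss01 n s : 0 <= minloss al n s <= 1.
Proof. by have [] := minloss_safe n. Qed.

Lemma minloss_nonincreasing s :
  {homo minloss al ^~ s : n m / (n <= m)%N >-> m <= n}.
Proof.
move=> n m nm; apply: le_minloss => l [l01 lB lc lp]; apply: minloss_le.
by split=> // t Bt mt; apply: lB => //; exact: leq_trans mt.
Qed.

(* The requirement at a state of code less than [n] can be met by lowering the
   loss at that single state. *)
Lemma minloss_le_backup n s c : (pickle s < n)%N -> 0 <= c ->
  (controlled M s -> exists2 z, al s z & minloss al n z <= c) ->
  (~~ controlled M s -> (expect (prob M s) (minloss al n) <= c%:E)%E) ->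
  minloss al n s <= c.
Proof.
move=> sn c0 hc hp; have [l01 lB lc lp] := minloss_safe n.
pose l t := if t == s then Num.min (minloss al n s) c else minloss al n t.
have ll t : l t <= minloss al n t.
  by rewrite /l; case: eqP => // ->; rewrite ge_min lexx.
suff /(minloss_le s) : safe_loss al n l.
  by rewrite /l eqxx le_min => /andP[].
split => [t|t Bt nt|t e ct e0|t ct].
- have := l01 t; rewrite /l; case: eqP => // -> /andP[m0 m1].
  by rewrite le_min m0 c0 ge_min m1.
- rewrite /l; case: eqP nt => [->|_ nt]; last exact: lB.
  by rewrite leqNgt sn.
- rewrite {2}/l; case: eqP => [ts|_].
    rewrite ts in ct *; case: (leP (minloss al n s) c) => _.
      by have [z sz h] := lc s e ct e0; exists z => //; exact: le_trans (ll z) h.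
    have [z sz h] := hc ct; exists z => //; apply: le_trans (ll z) _.
    by apply: le_trans h _; rewrite lerDl ltW.
  by have [z sz h] := lc t e ct e0; exists z => //; exact: le_trans (ll z) h.
- have [p0 _ _] := prob_distribution ct.
  apply: (@le_trans _ _ (expect (prob M t) (minloss al n))).
    by apply: le_expect.
  rewrite /l; case: eqP => [ts|_]; last exact: lp.
  rewrite ts in ct *; case: (leP (minloss al n s) c) => _; first exact: lp.
  exact: hp.
Qed.

(** Visits to [B] at the finitely many states of code less than [n] are free; letting [n] grow
    passes from safety to the co-Buchi objective. *)
Definition loss s : R := inf (range (minloss al ^~ s)).

Let hinf_range s : has_inf (range (minloss al ^~ s)).
Proof.
split; first by exists (minloss al 0%N s), 0%N.
by exists 0 => _ [n _ <-]; have /andP[] := minloss01 n s.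
Qed.

Lemma loss_le_minloss n s : loss s <= minloss al n s.
Proof. by apply: ge_inf; [have [] := hinf_range s|exists n]. Qed.

Lemma loss_le n l s : safe_loss al n l -> loss s <= l s.
Proof. by move=> sl; apply: le_trans (loss_le_minloss n s) (minloss_le s sl). Qed.

Lemma le_loss k s c : (forall n, (k <= n)%N -> c <= minloss al n s) -> c <= loss s.
Proof.
move=> h; apply: lb_le_inf; first by have [] := hinf_range s.
move=> _ [n _ <-]; apply: le_trans (h (maxn k n) (leq_maxl _ _)) _.
exact/minloss_nonincreasing/leq_maxr.
Qed.

Lemma loss01 s : 0 <= loss s <= 1.
Proof.
have /andP[_ h] := minloss01 0 s; rewrite (le_trans (loss_le_minloss 0 s) h) andbT.
by apply: (@le_loss 0%N) => n _; have /andP[] := minloss01 n s.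
Qed.

Lemma minloss_le_loss s e : 0 < e -> exists n, minloss al n s <= loss s + e.
Proof.
by move=> e0; have [_ [n _ <-] /ltW] := inf_adherent e0 (hinf_range s); exists n.
Qed.

Lemma loss_adherent s e : 0 < e ->
  exists n, exists2 l, safe_loss al n l & l s <= loss s + e.
Proof.
move=> /(minloss_le_loss s)[n h]; exists n, (minloss al n) => //.
exact: minloss_safe.
Qed.

(** The converse of the safety inequality: once [n] exceeds the code of [s], being in [B] costs
    nothing at [s] itself, and [minloss] there is at most its value at any allowed successor. *)
Lemma loss_step s z : controlled M s -> al s z -> loss s <= loss z.
Proof.
move=> cs sz; apply: (@le_loss (pickle s).+1) => n sn.
apply: le_trans (loss_le_minloss n s) _.
apply: minloss_le_backup => //; last by rewrite cs.
  by have /andP[] := minloss01 n z.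
by exists z.
Qed.

(** As for [loss_step]; the infimum over [n] is exchanged with the expectation by monotone
    convergence, starting at indices for which [s] is free. *)
Lemma loss_prob s : ~~ controlled M s -> ((loss s)%:E <= expect (prob M s) loss)%E.
Proof.
move=> cs; have dd := prob_distribution cs.
apply: (expect_monotone_ge (F := fun n => minloss al (n + (pickle s).+1)) dd).
- by move=> t n m nm; apply: minloss_nonincreasing; rewrite leq_add2r.
- by move=> n t; exact: minloss01.
- exact: loss01.
- move=> t e /(minloss_le_loss t)[n h]; exists n; apply: le_trans h.
  exact/minloss_nonincreasing/leq_addr.
- move=> n; set m := (n + _)%N.
  have fin : expect (prob M s) (minloss al m) \is a fin_num.
    exact: expect_fin dd (minloss01 m).
  rewrite -(fineK fin) lee_fin; apply: le_trans (loss_le_minloss m s) _.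
  apply: minloss_le_backup.
  + by rewrite /m leq_addl.
  + rewrite fine_ge0// expect_ge0 => // t; last by have /andP[] := minloss01 m t.
    by have [] := dd.
  + by rewrite (negbTE cs).
  + by rewrite fineK.
Qed.

End nonempty.
End losses.

(** * Refinement of the moves *)

Section refinement.
Context (R : realType) (S : countType) (M : mdp R S) (B : set S).
Hypothesis UT : universally_transient M.

(* One step of Ornstein's scheme: choices are fixed on the set [A] where a
   nearly optimal safe strategy is good.  The loss grows by at most [eta]
   everywhere, since on reaching [A] one may switch to that strategy, while a
   supermartingale [W] bounds the probability that the strategy started in [x]
   fails or leaves [A]. *)
Lemma refine_moves (al : S -> set S) x (eta eps : R) :
  (forall s, al s !=set0) -> (forall s, al s `<=` step M s) ->
  0 < eta -> 0 < eps ->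
  exists al' : S -> set S,
  [/\ forall s, al' s !=set0,
      forall s, al' s `<=` al s,
      exists y, al' x = [set y],
      forall s, loss M B al' s <= loss M B al s + eta
    & exists n (W : S -> R),
      [/\ forall s, 0 <= W s,
          forall s, B s -> (n <= pickle s)%N -> 1 <= W s,
          forall s z, W s < 1 -> controlled M s -> al' s z -> W z <= W s,
          forall s, W s < 1 -> ~~ controlled M s ->
            (expect (prob M s) W <= (W s)%:E)%E
        & W x <= loss M B al x + eps]].
Proof.
move=> al0 alM eta0 eps0.
(* It will turn out that [L x <= 2 * e]. So [2 * e <= eta] puts [x] into the region to be fixed, and
   the other two bounds let [w x - m x] and [eta^-1 * L x] each contribute at most [eps / 2] to
   [W x]. *)
pose e := Num.min (eta / 2) (Num.min (eps / 4) (eta * eps / 4)).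
have e0 : 0 < e by rewrite !lt_min !divr_gt0 ?mulr_gt0.
have [e1 e2 e3] : [/\ 2 * e <= eta, 4 * e <= eps & 4 * e <= eta * eps].
  have : e <= eta / 2 by rewrite /e ge_min lexx.
  have : e <= eps / 4 by rewrite /e !ge_min lexx !orbT.
  have : e <= eta * eps / 4 by rewrite /e !ge_min lexx !orbT.
  by move=> *; split; lra.
have [lam [Lam [lam0 Lame Lamc Lamp]]] := lyapunov_exists UT e0.
have Lam0 s : 0 <= Lam s by have /andP[] := Lame s.
have [n [l sl lx]] := loss_adherent M B al0 x e0; have [l01 lB lc lp] := sl.
have l0 s : 0 <= l s by have /andP[] := l01 s.
have /choice[g gP] : forall s, exists z,
    al s z /\ (controlled M s -> l z <= l s + lam s).
  move=> s; have [cs|cs] := boolP (controlled M s).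
    by have [z sz h] := lc s _ cs (lam0 s); exists z.
  by have [z sz] := al0 s; exists z.
have alg s : al s (g s) by have [] := gP s.
(* The greedy move [g] may raise [l] by [lam], which the decrease of [Lam] compensates. *)
pose w s := l s + Lam s.
have w0 s : 0 <= w s by rewrite addr_ge0.
have wc s : controlled M s -> w (g s) <= w s.
  move=> cs; have [sg /(_ cs)] := gP s.
  by have := Lamc s (g s) cs (alM _ _ sg); rewrite /w; lra.
have wp s : ~~ controlled M s -> (expect (prob M s) w <= (w s)%:E)%E.
  move=> cs; have [p0 _ _] := prob_distribution cs.
  by rewrite /w expectD// EFinD leeD ?lp ?Lamp.
pose m := loss M B al.
have m0 s : 0 <= m s by have /andP[] := loss01 M B al0 s.
have ml s : m s <= l s by exact: loss_le sl.
(* The excess over the optimal loss. Under [g], [w] does not increase and [m] does not decrease on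
   average, so [L] is a supermartingale. *)
pose L s := w s - m s.
have L0 s : 0 <= L s by rewrite /L /w; have := ml s; have := Lam0 s; lra.
have Lc s : controlled M s -> L (g s) <= L s.
  by move=> cs; have := loss_step B al0 cs (alg s); have := wc s cs; rewrite /L -/m; lra.
have Lp s : ~~ controlled M s -> (expect (prob M s) L <= (L s)%:E)%E.
  move=> cs; have dd := prob_distribution cs; have [p0 _ _] := dd.
  have fin : expect (prob M s) m \is a fin_num.
    exact: expect_fin dd (loss01 M B al0).
  rewrite -(leeD2rE _ _ fin) -expectD//.
  have -> : (fun t => L t + m t) = w by apply/funext => t; rewrite /L subrK.
  apply: le_trans (wp _ cs) _; rewrite -[w s](subrK (m s)) EFinD leeD2l//.
  exact: loss_prob.
(* The second term reaches 1 when [L] reaches [eta], so [W < 1] guarantees that the play is still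
   where [g] is enforced. *)
pose W s := w s + eta^-1 * L s.
have W0 s : 0 <= W s by rewrite addr_ge0// mulr_ge0// invr_ge0 ltW.
have inA s : W s < 1 -> L s <= eta.
  move=> W1; rewrite leNgt; apply/negP => Ls.
  have : 1 < eta^-1 * L s by rewrite mulrC ltr_pdivlMr// mul1r.
  by have := w0 s; move: W1; rewrite /W; lra.
have Lx : L x <= 2 * e.
  by rewrite /L /w; have /andP[_] := Lame x; move: lx; rewrite -/m; lra.
pose al' s := [set z | al s z /\ (L s <= eta -> z = g s)].
exists al'; split.
- by move=> s; exists (g s); split.
- by move=> s z [].
- exists (g x); apply/seteqP; split => [z [_]|z ->]; last by split.
  by apply; apply: le_trans e1.
- have al'0 s : al' s !=set0 by exists (g s); split.
  move=> s; rewrite -lerBlDr; apply: (@le_loss _ _ M B al al0 0%N) => k _.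
  apply: le_minloss => // l2 sl2; have [l201 l2B l2c l2p] := sl2; rewrite lerBlDr.
  (* Play as for [l2] until the fixed region is entered, then follow [g]. There [L t <= eta] gives
     [w t <= m t + eta <= l2 t + eta], so the switch loses at most [eta]. The index [maxn n k] meets
     the requirements of both [l] and [l2]. *)
  pose l' t := Num.min 1 (Num.min (l2 t + eta) (w t)).
  have l'0 t : 0 <= l' t.
    by rewrite !le_min ler01 w0 addr_ge0 ?(ltW eta0)//; have /andP[] := l201 t.
  suff sl' : safe_loss M B al' (maxn n k) l'.
    by apply: le_trans (loss_le al'0 s sl') _; rewrite !ge_min lexx orbT.
  split=> [t|t Bt|t d ct d0|t ct].
  + by rewrite l'0 ge_min lexx.
  + rewrite geq_max => /andP[nt kt]; apply/min_idPl; rewrite le_min.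
    rewrite l2B// lerDl (ltW eta0) /= /w lB// lerDl//.
  + have [tA|tA] := leP (L t) eta.
      exists (g t); first by split.
      have wl2 : w t <= l2 t + eta.
        have := loss_le al0 t sl2; move: tA; rewrite /L -/m; lra.
      apply: (@le_trans _ _ (l' t)); last by rewrite lerDl ltW.
      rewrite {2}/l' (min_idPr wl2) le_min; rewrite /l'.
      by rewrite !ge_min lexx (wc _ ct) /= !orbT.
    have al't z : al t z -> al' t z by move=> tz; split => // Lt; exfalso; lra.
    have [z tz lz] := l2c t d ct d0.
    have [l1|l1] := leP 1 (Num.min (l2 t + eta) (w t)).
      exists z; first exact: al't.
      by rewrite {2}/l' (min_idPl l1) /l' ge_min; apply/orP; left; lra.
    rewrite {2}/l' (min_idPr (ltW l1)).
    have [h|h] := leP (l2 t + eta) (w t).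
      by exists z; [exact: al't|rewrite !ge_min; apply/orP; right; apply/orP; left; lra].
    exists (g t); first exact: al't.
    by rewrite !ge_min; apply/orP; right; apply/orP; right; have := wc t ct; lra.
  + have dd := prob_distribution ct; have [p0 _ _] := dd.
    have El' (f : S -> R) : (forall u, l' u <= f u) ->
        (expect (prob M t) l' <= expect (prob M t) f)%E.
      by move=> lf; apply: le_expect.
    rewrite EFin_min le_min; apply/andP; split.
      by rewrite -(expect_cst dd ler01); apply: El' => u; rewrite ge_min lexx.
    rewrite EFin_min le_min; apply/andP; split.
      apply: (@le_trans _ _ (expect (prob M t) (fun u => l2 u + eta)%R)).
        by apply: El' => u; rewrite !ge_min lexx !orbT.
      rewrite expectD//; last 2 first.
        by move=> u; have /andP[] := l201 u.
        by move=> u; exact: ltW.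
      by rewrite EFinD (expect_cst dd (ltW eta0)) leeD2r// l2p.
    by apply: le_trans (wp _ ct); apply: El' => u; rewrite !ge_min lexx !orbT.
- exists n, W; split => //.
  + move=> s Bs ns; apply: (@le_trans _ _ (l s)); first by rewrite lB.
    by rewrite /W /w -addrA lerDl addr_ge0// mulr_ge0// invr_ge0 ltW.
  + move=> s z /inA sA cs [_ /(_ sA) ->].
    by rewrite /W lerD ?wc// ler_wpM2l ?Lc// invr_ge0 ltW.
  + move=> s _ cs; have [p0 _ _] := prob_distribution cs.
    have ei0 : 0 <= eta^-1 by rewrite invr_ge0 ltW.
    rewrite /W expectD//; last by move=> t; rewrite mulr_ge0.
    rewrite expectZ// EFinD leeD ?wp// EFinM lee_wpmul2l ?lee_fin// Lp//.
  + have h : eta^-1 * L x <= eps / 2.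
      by rewrite mulrC ler_pdivrMr//; lra.
    have /andP[_ h2] := Lame x.
    by rewrite /W /w -/m; move: lx; rewrite -/m; lra.
Qed.

End refinement.

(** * Uniform strategies *)

Section uniform_strategy.
Context (R : realType) (S : countType) (M : mdp R S) (B : set S).
Hypothesis UT : universally_transient M.

(** Stage [k] refines the moves at the state of code [k]. The losses [eta k] sum to [eps / 2], the
    other half being spent on [W]. A [W] found at one stage stays valid for [f], because [f] obeys
    the restrictions of all stages. *)
Lemma uniform_choice (eps : R) : 0 < eps -> exists f : S -> S,
  (forall s, step M s (f s)) /\
  forall x, exists n (W : S -> R),
    [/\ forall s, 0 <= W s,
        forall s, B s -> (n <= pickle s)%N -> 1 <= W s,
        forall s, W s < 1 -> controlled M s -> W (f s) <= W s,
        forall s, W s < 1 -> ~~ controlled M s ->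
          (expect (prob M s) W <= (W s)%:E)%E
      & W x <= loss M B (step M) x + eps].
Proof.
move=> eps0; have eps20 : 0 < eps / 2 by lra.
pose restriction := {al : S -> set S |
  (forall s, al s !=set0) /\ (forall s, al s `<=` step M s)}.
pose moves (a : restriction) := proj1_sig a.
pose eta k : R := eps / 2 * 2^-1 ^+ k.+1.
have eta0 k : 0 < eta k by rewrite mulr_gt0// exprn_gt0 ?invr_gt0.
pose refines k (al al' : S -> set S) :=
  [/\ forall s, al' s `<=` al s,
      forall s, loss M B al' s <= loss M B al s + eta k
    & forall x, @pickle_inv S k = Some x ->
      (exists y, al' x = [set y]) /\
      exists n (W : S -> R),
      [/\ forall s, 0 <= W s,
          forall s, B s -> (n <= pickle s)%N -> 1 <= W s,
          forall s z, W s < 1 -> controlled M s -> al' s z -> W z <= W s,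
          forall s, W s < 1 -> ~~ controlled M s ->
            (expect (prob M s) W <= (W s)%:E)%E
        & W x <= loss M B al x + eps / 2]].
have /choice[next nextP] : forall k, exists F : restriction -> restriction,
    forall a, refines k (moves a) (moves (F a)).
  move=> k; suff /choice[F FP] : forall a : restriction, exists a' : restriction,
      refines k (moves a) (moves a') by exists F.
  move=> a; have [al0 alM] := proj2_sig a.
  case E : (@pickle_inv S k) => [x|]; last first.
    by exists a; split => [s z //|s|x]; [rewrite lerDl ltW|rewrite E].
  have [al' [al'0 al'al al'x al'l al'W]] :=
    refine_moves B UT x al0 alM (eta0 k) eps20.
  have al'P : (forall s, al' s !=set0) /\ (forall s, al' s `<=` step M s).
    by split => // s; exact: subset_trans (alM s).
  exists (exist _ al' al'P); split => // y; rewrite E => -[<-].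
  by split.
have stepP : (forall s, step M s !=set0) /\ (forall s, step M s `<=` step M s).
  by split=> [|s z]; [exact: step_total|].
pose a := fix a k := if k is k'.+1 then next k' (a k') else exist _ _ stepP.
have aS k : a k.+1 = next k (a k) by [].
have a_sub s i j : (i <= j)%N -> moves (a j) s `<=` moves (a i) s.
  move=> /subnK <-; elim: (j - i)%N => [//|m IH].
  by rewrite addSn aS; have [h _ _] := nextP (m + i)%N (a (m + i)%N);
     exact: subset_trans (h s) IH.
have a_loss s k : loss M B (moves (a k)) s <=
    loss M B (step M) s + eps / 2 * (1 - 2^-1 ^+ k).
  elim: k => [|k IH]; first by rewrite expr0 subrr mulr0 addr0.
  rewrite aS; have [_ /(_ s) h _] := nextP k (a k); apply: le_trans h _.
  apply: le_trans (lerD IH (lexx _)) _.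
  by rewrite -addrA lerD2l /eta -mulrDr ler_wpM2l ?(ltW eps20)// exprS; lra.
have /choice[f fP] : forall x, exists y, moves (a (pickle x).+1) x = [set y].
  move=> x; rewrite aS; have [_ _ /(_ x)] := nextP (pickle x) (a (pickle x)).
  by rewrite pickleK_inv => /(_ erefl)[].
have fa s k : moves (a k) s (f s).
  have fs : moves (a (pickle s).+1) s (f s) by rewrite fP.
  have [h|/ltnW h] := leqP k (pickle s).+1; first exact: a_sub h _ fs.
  (* Later stages only shrink the moves and keep them nonempty, so a singleton persists. *)
  have [z sz] : moves (a k) s !=set0 by have [] := proj2_sig (a k).
  have := a_sub s _ _ h z sz; rewrite fP => zf.
  by rewrite -zf.
exists f; split => [s|x]; first exact: (fa s 0%N).
have [_ _ /(_ x)] := nextP (pickle x) (a (pickle x)).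
rewrite pickleK_inv -aS => /(_ erefl)[_ [n [W [W0 WB Wc Wp Wx]]]].
exists n, W; split => // [s W1 cs|]; first exact: Wc.
have half0 : 0 < 2^-1 ^+ pickle x :> R by rewrite exprn_gt0 ?invr_gt0.
apply: le_trans Wx _; have := a_loss x (pickle x).
have : eps / 2 * (1 - 2^-1 ^+ pickle x) <= eps / 2.
  by apply: ler_piMr; [exact: ltW|lra].
lra.
Qed.

End uniform_strategy.

(** * Hitting probabilities under arbitrary strategies *)

Section hitting.
Context (R : realType) (S : countType) (M : mdp R S) (B : set S) (n : nat).

(** The starting time [k] allows conditioning on a history of length [k]. *)
Definition hits_after (k : nat) : set (nat -> S) :=
  [set x | exists2 j, (k <= j)%N & B (x j) /\ (n <= pickle (x j))%N].

Lemma measurable_hits_after (s0 : S) k :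
  measurable (hits_after k : set (runspace s0)).
Proof.
rewrite (_ : hits_after k = \bigcup_(j in [set j | (k <= j)%N])
    [set x | [set s | B s /\ (n <= pickle s)%N] (x j)]).
  by apply: bigcup_measurable => j _; exact: measurable_coord.
by apply/seteqP; split => [x [j kj h]|x [j kj h]]; exists j.
Qed.

(** Memory is eliminated by taking, at each state, the infimum over all histories of the conditional
    hitting probability. The result is a safe loss, hence bounds [loss] from above. *)
Lemma loss_le_hits (sigma : strategy M) s0 :
  ((loss M B (step M) s0)%:E <= run_measure sigma s0 (hits_after 0))%E.
Proof.
pose mu := run_measure sigma s0.
pose cp w := cylinder_prob sigma s0 w.
have cp0 w : 0 <= cp w := cylinder_prob_ge0 sigma s0 w.
pose ev rho s k : set (runspace s0) := cylinder (rcons rho s) `&` hits_after k.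
have mev rho s k : measurable (ev rho s k).
  by apply: measurableI; [exact: measurable_cylinder|exact: measurable_hits_after].
have ev_le rho s k : (mu (ev rho s k) <= (cp (rcons rho s))%:E)%E.
  rewrite -run_measure_cylinder; apply: le_measure; rewrite ?inE//.
    exact: measurable_cylinder.
  by move=> x [].
(* On null histories the default 1 satisfies both the requirement on [B] and [q_step]. *)
pose q rho s : R := if cp (rcons rho s) == 0 then 1
  else fine (mu (ev rho s (size rho))) / cp (rcons rho s).
have evE : forall rho s, cp (rcons rho s) != 0 ->
    mu (ev rho s (size rho)) = (cp (rcons rho s) * q rho s)%:E.
  by move=> rho s h; rewrite /q (negbTE h) mulrC divfK// fineK// fin_num_measure//.
have q01 rho s : 0 <= q rho s <= 1.
  have [h|h] := eqVneq (cp (rcons rho s)) 0; first by rewrite /q h eqxx ler01 lexx.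
  have cpos : 0 < cp (rcons rho s) by rewrite lt_neqAle eq_sym h cp0.
  have := ev_le rho s (size rho); rewrite evE// lee_fin ger_pMr// => ->.
  rewrite andbT /q (negbTE h) divr_ge0 ?fine_ge0//.
pose l s := inf (range (q ^~ s)).
have hl s : has_inf (range (q ^~ s)).
  split; first by exists (q [::] s), [::].
  by exists 0 => _ [rho _ <-]; have /andP[] := q01 rho s.
have lq rho s : l s <= q rho s by apply: ge_inf; [have [] := hl s|exists rho].
have lel s c : (forall rho, c <= q rho s) -> c <= l s.
  by move=> h; apply: lb_le_inf; [have [] := hl s|move=> _ [rho _ <-]].
have l01 s : 0 <= l s <= 1.
  have /andP[_ h] := q01 [::] s; rewrite (le_trans (lq [::] s) h) andbT.
  by apply: lel => rho; have /andP[] := q01 rho s.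
(* Hitting from the next step on is a smaller event, and its conditional probability averages values
   of [q] at the successors, each at least [l]. *)
have q_step rho s : (expect (transition sigma rho s) l <= (q rho s)%:E)%E.
  have dd := transition_distribution sigma rho s; have [tr0 _ _] := dd.
  have [h|h] := eqVneq (cp (rcons rho s)) 0.
    rewrite /q h eqxx; apply: expect_le_cst dd _ _ => // t _.
    by have /andP[] := l01 t.
  have cpos : 0 < cp (rcons rho s) by rewrite lt_neqAle eq_sym h cp0.
  rewrite -(@lee_pmul2l _ (cp (rcons rho s))%:E)// -EFinM -evE//.
  rewrite -expectZ//; last by move=> t; have /andP[] := l01 t.
  apply: (@le_trans _ _ (mu (ev rho s (size rho).+1))); last first.
    apply: le_measure; rewrite ?inE//; apply: setIS => y [j kj yj].
    by exists j => //; exact: ltnW.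
  rewrite /ev measure_cylinder_split//; last exact: measurable_hits_after.
  apply: le_esum => t _; rewrite mulrCA mulrA -cylinder_prob_rcons2.
  have [ht|ht] := eqVneq (cp (rcons (rcons rho s) t)) 0.
    by rewrite -/(cp _) ht mul0r.
  have := evE (rcons rho s) t ht; rewrite /ev size_rcons => ->.
  by rewrite lee_fin ler_wpM2l.
have sl : safe_loss M B (step M) n l.
  split=> // [s Bs ns|s e cs e0|s cs].
  - apply/eqP; rewrite eq_le; have /andP[_ ->] := l01 s; apply: lel => rho.
    have [h|h] := eqVneq (cp (rcons rho s)) 0; first by rewrite /q h eqxx.
    have := evE rho s h; rewrite (_ : ev _ _ _ = cylinder (rcons rho s)).
      rewrite run_measure_cylinder => -[] /eqP; rewrite -/(cp _).
      by rewrite -{1}[cp _]mulr1 (inj_eq (mulfI h)) => /eqP <-.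
    apply/seteqP; split => [y []//|y /[dup] yc /cylinder_rconsE[_ ys]].
    by split => //; exists (size rho) => //; rewrite ys.
  - have e20 : 0 < e / 2 by lra.
    have [_ [rho _ <-] qs] := inf_adherent e20 (hl s).
    have dd := transition_distribution sigma rho s.
    have [|t st lt] := expect_exists_le dd _ e20 (q_step rho s).
      by have /andP[] := q01 rho s.
    by exists t => //; move: qs lt; rewrite -/(l s); lra.
  - have dd := prob_distribution cs.
    have fin : expect (prob M s) l \is a fin_num by exact: expect_fin dd l01.
    rewrite -(fineK fin) lee_fin; apply: lel => rho; rewrite -lee_fin fineK//.
    by have := q_step rho s; rewrite /transition (negbTE cs).
apply: (@le_trans _ _ (q [::] s0)%:E).
  rewrite lee_fin; apply: le_trans (loss_le _ s0 sl) (lq [::] s0).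
  exact: step_total.
have cp1 : cp (rcons [::] s0) = 1 by rewrite /cp /= eqxx mulr1.
have := evE [::] s0; rewrite cp1 mul1r oner_neq0 => /(_ isT) <-.
rewrite [leRHS]run_measure_init//; exact: measurable_hits_after.
Qed.

End hitting.

(** * Co-Buchi objectives *)

Section co_buchi.
Context (R : realType) (S : countType) (M : mdp R S) (Col : S -> 'I_2).
Let B : set S := [set s | Col s = ord_max].

Lemma parity_co_buchi (x : nat -> S) :
  parity M Col x <-> run M x /\ finite_set [set n | B (x n)].
Proof.
split => [[rx [c [_ cmax codd]]]|[rx fx]]; split => //.
  apply: contrapT => /(cmax ord_max) h; move: codd.
  by case: c {cmax} h => -[|[|m]].
have inf0 : inf_colors Col x ord0.
  move=> f0; apply: infinite_nat.
  have -> : [set: nat] = [set m | Col (x m) = ord0] `|` [set m | B (x m)].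
    apply/seteqP; split => // m _; have [h|h] := eqVneq (Col (x m)) ord0.
      by left.
    right; apply/val_inj => /=; move: h; rewrite -val_eqE /=.
    by case: (Col (x m)) => -[|[|]].
  by rewrite finite_setU.
exists ord0; split => // c.
by have [->|c1] := eqVneq c ord_max; last by case: c c1 => -[|[|]].
Qed.

(** A winning run meets [B] finitely often, so it avoids all states of [B] of code at least some
    [n]; continuity from below in [n] reduces this to [loss_le_hits]. *)
Lemma value_le_loss s :
  (value M (parity M Col) s <= 1 - (loss M B (step M) s)%:E)%E.
Proof.
apply: ge_ereal_sup => _ [sigma _ <-]; set mu := run_measure sigma s.
pose F n : set (runspace s) := ~` hits_after B n 0.
have mF n : measurable (F n) by apply: measurableC; exact: measurable_hits_after.
apply: (@le_trans _ _ (mu (\bigcup_n F n))).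
  apply: le_measure; rewrite ?inE; first exact: measurable_parity.
    exact: bigcup_measurable.
  move=> x /parity_co_buchi[_ /finite_seqP[r rE]].
  exists (\max_(i <- r) pickle (x i)).+1 => // -[j _ [Bj]].
  rewrite ltnNge => /negP; apply; apply: leq_bigmax_seq => //.
  by move: (Bj : [set n | B (x n)] j); rewrite rE.
apply: measure_nondecreasing_bigcup_le => // [i j ij|i].
  apply/subsetPset => x; apply: contra_not => -[k _ [Bk jk]].
  by exists k => //; split => //; exact: leq_trans jk.
rewrite /F probability_setC; last exact: measurable_hits_after.
by apply: leeB => //; exact: loss_le_hits.
Qed.

End co_buchi.

(** Only finitely many states have code less than [n], and a transient run visits each of them
    finitely often; without other visits to [B] it is winning. *)
Lemma transience_sub (R : realType) (S : countType) (M : mdp R S)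
    (Col : S -> 'I_2) n :
  transience M `<=` parity M Col `|` hits_after [set s | Col s = ord_max] n 0.
Proof.
move=> x [rx tx].
have [h|nh] := pselect (hits_after [set s | Col s = ord_max] n 0 x); [by right|left].
apply/parity_co_buchi; split => //.
have finn : finite_set [set s : S | (pickle s < n)%N].
  apply: (@finite_preimage _ _ `I_n (@pickle S)); last exact: finite_II.
  by move=> s t _ _ /(pcan_inj (@pickleK S)).
apply: (@sub_finite_set _ _ (\bigcup_(s in [set s | (pickle s < n)%N]) [set m | x m = s])).
  move=> m Bm; exists (x m) => //=; rewrite ltnNge; apply/negP => nm.
  by apply: nh; exists m.
by apply: bigcup_finite.
Qed.

Theorem theorem11 (R : realType) (S : countType) (M : mdp R S)
    (Col : S -> 'I_2) (eps : R) :
  universally_transient M -> 0 < eps ->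
  exists sigma' : strategy M,
    memoryless_deterministic sigma' /\
    forall s : S,
      (value M (parity M Col) s - eps%:E
         <= run_measure sigma' s (parity M Col))%E.
Proof.
move=> UT eps0; pose B : set S := [set s | Col s = ord_max].
have [f [fstep fW]] := uniform_choice B UT eps0.
pose sigma := det_strategy (fun (rho : seq S) s (_ : controlled M s) => fstep s).
exists sigma; split; first by exists f.
move=> s; have [n [W [W0 WB Wc Wp Ws]]] := fW s.
set mu := run_measure sigma s.
have mH : measurable (hits_after B n 0 : set (runspace s)).
  exact: measurable_hits_after.
have mP : measurable (parity M Col : set (runspace s)) by exact: measurable_parity.
have Wsup (rho : seq S) t : W t < 1 ->
    (expect (transition sigma rho t) W <= (W t)%:E)%E.
  move=> W1; rewrite expect_det_strategy//; case: ifPn => ct; last exact: Wp.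
  by rewrite lee_fin Wc.
have hit : (mu (hits_after B n 0) <= (W s)%:E)%E.
  apply: le_trans (@ville R S M sigma s (fun=> W) (fun=> W0) Wsup).
  apply: le_measure; rewrite ?inE//.
    rewrite (_ : [set x | _] = \bigcup_k [set x | [set t | 1 <= W t] (x k)]).
      by apply: bigcupT_measurable => k; exact: measurable_coord.
    by apply/seteqP; split => [x [k h]|x [k _ h]]; exists k.
  by move=> x [k _ [Bk nk]]; exists k; exact: WB.
(* Transience has probability 1, so avoiding the states of [B] of code at least [n] is almost surely
   enough to win; the failure probability is thus at most [W s]. *)
have total : (1 <= mu (parity M Col) + mu (hits_after B n 0))%E.
  rewrite -(UT s sigma); apply: le_trans (measureU2 mu mP mH).
  apply: le_measure; rewrite ?inE; first exact: measurable_transience.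
    exact: measurableU.
  exact: transience_sub.
have fin : mu (parity M Col) \is a fin_num by exact: fin_num_measure.
have := le_trans total (leeD (lexx (mu (parity M Col))) hit).
rewrite -(fineK fin) -EFinD lee_fin => h.
apply: le_trans (leeB (value_le_loss M Col s) (lexx eps%:E)) _.
by rewrite -!EFinB lee_fin; move: Ws h; rewrite -/B; lra.
Qed.
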